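(* Let $X$ be an infinite zero-dimensional compact metric space. Let $K$ be the commutative subgroup of $H(X)$ generated by (pairwise commuting) $\{\psi_1,\dots,\psi_d\}$. Let $\alpha:\mathbb Z^d\to K$ be the $\mathbb Z^d$-action defined by $\alpha^{(m_1,\dots,m_d)}=\psi_1^{m_1}\cdots\psi_d^{m_d}$. (1) Two integral vectors $\mathbf m=(m_1,\dots,m_d)$ and $\mathbf n=(n_1,\dots,n_d)$ in $\mathbb R^d$ belong to the same expansive component of 1-frames for $\alpha$ if and only if $\psi_1^{m_1}\cdots\psi_d^{m_d}\in C_K^\circ(\psi_1^{n_1}\cdots\psi_d^{n_d})$, i.e. $\alpha^{\mathbf n}$ is expansive and $\alpha^{\mathbf m}$ is an expansive essentially weakly LR automorphism of $(X,\alpha^{\mathbf n})$. (2)(a) A set of integral vectors is of the form $\mathcal C\cap\mathbb Z^d$, where $\mathcal C$ is an expansive component of 1-frames for $\alpha$, if and only if it is of the form $\Lambda(C^\circ)=\{\mathbf n\in\mathbb Z^d:\alpha^{\mathbf n}\in C^\circ\}$, where $C^\circ$ is the interior of an essentially-weakly-LR cone $C$ in $K$. (b) A set of integral vectors is of the form $\mathcal C\cap\mathbb Z^d$, where $\mathcal C$ is a Markov component for $\alpha$, if and only if it is of the form $\Lambda(C^\circ)=\{\mathbf n\in\mathbb Z^d:\alpha^{\mathbf n}\in C^\circ\}$, where $C^\circ$ is the interior of an ELR cone $C$ in $K$.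
   Context: **Basics.** $H(X)$ is the group of homeomorphisms of $X$; $d_X$ is the metric. A homeomorphism $\tau$ of $X$ is expansive if there is $\delta>0$ such that $d_X(\tau^j(x),\tau^j(y))\le\delta$ for all $j\in\mathbb Z$ implies $x=y$. An automorphism of $(X,\tau)$ is a homeomorphism of $X$ commuting with $\tau$. A subshift $(X',\sigma')$ over a finite alphabet $A$ is a closed $X'\subset A^{\mathbb Z}$ with $\sigma'(X')=X'$, $\sigma'$ being the shift $(a_j)\mapsto(a_{j+1})$. SFT means subshift of finite type. **Essentially weakly LR.** A graph is a finite directed graph $G$ (multiple arcs, loops allowed) with arc-set $A_G$, vertex-set $V_G$ and initial/terminal vertex maps $i_G,t_G$; $X_G\subset A_G^{\mathbb Z}$ is the set of bi-infinite paths. A graph-homomorphism $h=(h_A,h_V):\Gamma\to G$ is a pair of maps on arcs and vertices compatible with $i,t$; it induces $\phi_h:X_\Gamma\to X_G$, $(\alpha_j)\mapsto(h_A(\alpha_j))$. $h$ is weakly left-resolving (resp. weakly right-resolving) if every arc $\gamma$ of $\Gamma$ is uniquely determined by $t_\Gamma(\gamma)$ (resp. $i_\Gamma(\gamma)$) and $h_A(\gamma)$. A weakly LR textile system is a pair $(p,q:\Gamma\to G)$ of graph-homomorphisms with $p$ weakly left-resolving and $q$ weakly right-resolving. A continuous shift-commuting map $\varphi':X'\to X'$ of a subshift is weakly LR if there are a weakly LR textile system $(p,q:\Gamma\to G)$ and a closed shift-invariant $Z\subset X_\Gamma$ such that $\phi_p|_Z$ is injective, $\phi_p(Z)=X'$,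 $\phi_q(Z)\subset X'$ and $\varphi'=\phi_q\circ(\phi_p|_Z)^{-1}$. An automorphism $\psi$ of $(X,\tau)$ is essentially weakly LR if there are a subshift $(X',\sigma')$, a weakly LR endomorphism $\varphi'$ of it and a homeomorphism $\theta:X\to X'$ with $\theta\tau=\sigma'\theta$, $\theta\psi=\varphi'\theta$. **Cones.** Let $E(K)$ be the set of expansive elements of $K$. For $\tau\in E(K)$, $C_K(\tau)$ is the set of $\psi\in K$ that are essentially weakly LR automorphisms of $(X,\tau)$, and $C_K^\circ(\tau)=C_K(\tau)\cap E(K)$. An essentially-weakly-LR cone in $K$ is a set $C=C_K(\tau)$ with $\tau\in E(K)$; its interior is $C^\circ=C\cap E(K)$. An ELR cone in $K$ is an essentially-weakly-LR cone $C$ in $K$ whose interior $C^\circ$ contains an element having POTP. (A homeomorphism $\psi$ has the pseudo orbit tracing property, POTP, if for every $\epsilon>0$ there is $\delta>0$ such that for every bisequence $(x_i')_{i\in\mathbb Z}$ with $d_X(\psi(x_i'),x_{i+1}')\le\delta$ for all $i$ there is an orbit $(x_i)$ of $\psi$ with $d_X(x_i,x_i')<\epsilon$ for all $i$.) **Expansive components.** For $F\subset\mathbb R^d$ and $t\ge0$, $F^t$ is the set of points at Euclidean distance at most $t$ from $F$. $F$ is expansive for $\alpha$ if there are $\delta>0$, $t\ge0$ such that for $x,y\in X$, $d_X(\alpha^{\mathbf m}(x),\alpha^{\mathbf m}(y))\le\delta$ for all $\mathbf m\in F^t\cap\mathbb Z^d$ implies $x=y$. $\mathcal E(\alpha)$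 is the union of all lines through $\mathbf 0$ in $\mathbb R^d$ that are expansive for $\alpha$, with $\mathbf 0$ removed. An expansive component of 1-frames for $\alpha$ is a connected component of $\mathcal E(\alpha)$. It is a Markov component if it contains an integral vector $\mathbf k$ with $(X,\alpha^{\mathbf k})$ topologically conjugate to an SFT. *)

(* Defs.v *)
From HB Require Import structures.
From mathcomp Require Import all_boot all_order all_algebra.
From mathcomp Require Import all_classical all_reals all_analysis.
Set Implicit Arguments.
Unset Strict Implicit.
Unset Printing Implicit Defensive.
Import Order.TTheory GRing.Theory Num.Theory.
Import numFieldNormedType.Exports.
Local Open Scope classical_set_scope.
Local Open Scope ring_scope.

(* The group H(T) of homeomorphisms of T; f * g is the composite f \o g. *)

Record homeo (T : topologicalType) := Homeo {
  homeo_fun :> T -> T;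
  homeo_inv : T -> T;
  homeo_funK : cancel homeo_fun homeo_inv;
  homeo_invK : cancel homeo_inv homeo_fun;
  homeo_continuous : continuous homeo_fun;
  homeo_inv_continuous : continuous homeo_inv
}.

Section HomeoGroup.
Context {T : topologicalType}.
Implicit Types f g h : homeo T.

Lemma homeo_eq f g : f =1 g -> f = g.
Proof.
case: f g => [f f' fK f'K cf cf'] [g g' gK g'K cg cg'] /= fg.
have {}fg : f = g by apply/funext.
subst g; have fg' : f' = g'.
  by apply/funext => x; rewrite -[in LHS](g'K x) fK.
subst g'; congr Homeo; exact: Prop_irrelevance.
Qed.

Lemma homeo_id_continuous : continuous (@idfun T).
Proof. by move=> x; apply: cvg_id. Qed.

Lemma homeo_comp_continuous (f g : T -> T) :
  continuous f -> continuous g -> continuous (f \o g).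
Proof. by move=> cf cg x; apply: continuous_comp; [exact: cg | exact: cf]. Qed.

Definition homeo_one : homeo T :=
  @Homeo T idfun idfun (fun=> erefl) (fun=> erefl) homeo_id_continuous homeo_id_continuous.

Definition homeo_mul f g : homeo T :=
  @Homeo T (f \o g) (homeo_inv g \o homeo_inv f)
    (can_comp (@homeo_funK T f) (@homeo_funK T g))
    (can_comp (@homeo_invK T g) (@homeo_invK T f))
    (homeo_comp_continuous (@homeo_continuous T f) (@homeo_continuous T g))
    (homeo_comp_continuous (@homeo_inv_continuous T g)
                           (@homeo_inv_continuous T f)).

Definition homeo_opp f : homeo T :=
  @Homeo T (homeo_inv f) f (@homeo_invK T f) (@homeo_funK T f)
    (@homeo_inv_continuous T f) (@homeo_continuous T f).

Lemma homeo_mulA : associative homeo_mul.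
Proof. by move=> f g h; apply: homeo_eq. Qed.

Lemma homeo_mul1 : left_id homeo_one homeo_mul.
Proof. by move=> f; apply: homeo_eq. Qed.

Lemma homeo_mulr1 : right_id homeo_one homeo_mul.
Proof. by move=> f; apply: homeo_eq. Qed.

Lemma homeo_mulV : left_inverse homeo_one homeo_opp homeo_mul.
Proof. by move=> f; apply: homeo_eq => x; exact: homeo_funK. Qed.

Lemma homeo_mulrV : right_inverse homeo_one homeo_opp homeo_mul.
Proof. by move=> f; apply: homeo_eq => x; exact: homeo_invK. Qed.

End HomeoGroup.

HB.instance Definition _ (T : topologicalType) := gen_eqMixin (homeo T).
HB.instance Definition _ (T : topologicalType) := gen_choiceMixin (homeo T).
HB.instance Definition _ (T : topologicalType) :=
  isGroup.Build (homeo T) (@homeo_mulA T) (@homeo_mul1 T) (@homeo_mulr1 T)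
    (@homeo_mulV T) (@homeo_mulrV T).

Definition expgz (G : groupType) (x : G) (n : int) : G :=
  match n with Posz k => (x ^+ k)%g | Negz k => (x ^- k.+1)%g end.

Definition is_subgroup (G : groupType) (H : set G) : Prop :=
  [/\ H 1%g, (forall x y, H x -> H y -> H (x * y)%g)
    & forall x, H x -> H (x^-1)%g].

Definition generated_subgroup (G : groupType) (S : set G) : set G :=
  smallest (@is_subgroup G) S.

Definition Zd_action (d : nat) (G : groupType) (psi : 'I_d -> G)
    (m : 'rV[int]_d) : G :=
  (\prod_(i < d) expgz (psi i) (m ord0 i))%g.

(* Two-sided symbolic dynamics. The full shift A^Z carries the product of the
   discrete topologies. *)

Notation fullshift A := {ptws int -> discrete_topology A}.

Definition shift_map (A : finType) (x : fullshift A) : fullshift A :=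
  fun j => x (j + 1).

Definition subshift (A : finType) (Y : set (fullshift A)) : Prop :=
  closed Y /\ @shift_map A @` Y = Y.

Definition block (A : finType) (x : fullshift A) (i : int) (n : nat) : seq A :=
  [seq (x (i + k%:Z) : A) | k <- iota 0 n].

Definition SFT (A : finType) (Y : set (fullshift A)) : Prop :=
  exists F : seq (seq A),
    Y = [set x | forall i w, w \in F -> block x i (size w) != w].

Definition homeo_onto (T U : topologicalType) (theta : T -> U) (Y : set U) :=
  exists theta' : U -> T,
    [/\ continuous theta, {within Y, continuous theta'},
        (forall x, Y (theta x)), cancel theta theta'
      & forall y, Y y -> theta (theta' y) = y].

Definition conjugacy (T : topologicalType) (tau : homeo T) (A : finType)
    (Y : set (fullshift A)) (theta : T -> fullshift A) : Prop :=
  homeo_onto theta Y /\ forall x, theta (tau x) = shift_map (theta x).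

Definition conjugate_to_SFT (T : topologicalType) (tau : homeo T) : Prop :=
  exists (A : finType) (Y : set (fullshift A)) (theta : T -> fullshift A),
    SFT Y /\ conjugacy tau Y theta.

(* [graph A] is the type of finite directed graphs with arc-set A. *)
Record graph (A : finType) := Graph {
  vertex : finType;
  initial : A -> vertex;
  terminal : A -> vertex
}.

Definition path_space (A : finType) (G : graph A) : set (fullshift A) :=
  [set x | forall j, terminal G (x j) = initial G (x (j + 1))].

Record graph_hom (B A : finType) (Gamma : graph B) (G : graph A) := GraphHom {
  arc_map : B -> A;
  vertex_map : vertex Gamma -> vertex G;
  arc_map_initial : forall b,
    initial G (arc_map b) = vertex_map (initial Gamma b);
  arc_map_terminal : forall b,
    terminal G (arc_map b) = vertex_map (terminal Gamma b)
}.

Section GraphHom.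
Context {B A : finType} {Gamma : graph B} {G : graph A}.
Variable h : graph_hom Gamma G.

Definition path_map (x : fullshift B) : fullshift A := fun j => arc_map h (x j).

Definition weakly_left_resolving :=
  injective (fun b => (terminal Gamma b, arc_map h b)).

Definition weakly_right_resolving :=
  injective (fun b => (initial Gamma b, arc_map h b)).

End GraphHom.

Definition weakly_LR_textile (B A : finType) (Gamma : graph B) (G : graph A)
    (p q : graph_hom Gamma G) : Prop :=
  weakly_left_resolving p /\ weakly_right_resolving q.

Definition endomorphism (A : finType) (Y : set (fullshift A))
    (phi : fullshift A -> fullshift A) : Prop :=
  [/\ {within Y, continuous phi}, phi @` Y `<=` Y
    & forall y, Y y -> phi (shift_map y) = shift_map (phi y)].

(* Only the values of phi on Y matter. Since p maps arcs of Gamma to arcs of G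
   and path_map p @` Z = Y, the alphabet A of Y is the arc-set of G. *)
Definition weakly_LR (A : finType) (Y : set (fullshift A))
    (phi : fullshift A -> fullshift A) : Prop :=
  endomorphism Y phi /\
  exists (B : finType) (Gamma : graph B) (G : graph A)
         (p q : graph_hom Gamma G) (Z : set (fullshift B)),
    weakly_LR_textile p q /\
    [/\ subshift Z, Z `<=` path_space Gamma
      & set_inj Z (path_map p)] /\
    [/\ path_map p @` Z = Y, path_map q @` Z `<=` Y
      & forall z, Z z -> phi (path_map p z) = path_map q z].

Definition essentially_weakly_LR (T : topologicalType) (tau psi : homeo T) :
    Prop :=
  commute psi tau /\
  exists (A : finType) (Y : set (fullshift A))
         (phi : fullshift A -> fullshift A) (theta : T -> fullshift A),
    [/\ subshift Y, weakly_LR Y phi, conjugacy tau Y theta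
      & forall x, theta (psi x) = phi (theta x)].

Section Expansive.
Context {R : realType} {X : metricType R}.
Implicit Types (tau psi : homeo X) (K C : set (homeo X)).

Definition expansive tau : Prop :=
  exists2 delta : R, 0 < delta & forall x y : X,
    (forall j : int, mdist (expgz tau j x) (expgz tau j y) <= delta) -> x = y.

Definition POTP psi : Prop :=
  forall eps : R, 0 < eps -> exists2 delta : R, 0 < delta &
    forall x' : int -> X,
      (forall i, mdist (psi (x' i)) (x' (i + 1)) <= delta) ->
      exists2 x : int -> X, (forall i, x (i + 1) = psi (x i)) &
        forall i, mdist (x i) (x' i) < eps.

Definition expansive_elements K : set (homeo X) := K `&` [set tau | expansive tau].

Definition LR_cone K tau : set (homeo X) :=
  K `&` [set psi | essentially_weakly_LR tau psi].

Definition cone_interior K C : set (homeo X) := C `&` expansive_elements K.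

Definition is_weakly_LR_cone K C : Prop :=
  exists2 tau, expansive_elements K tau & C = LR_cone K tau.

Definition is_ELR_cone K C : Prop :=
  is_weakly_LR_cone K C /\ exists2 psi, cone_interior K C psi & POTP psi.

Section Components.
Context {d : nat}.
Implicit Types (alpha : 'rV[int]_d -> homeo X) (F : set 'rV[R]_d).

(* The library norm on row vectors is the sup norm. *)
Definition euclidean_norm (v : 'rV[R]_d) : R :=
  Num.sqrt (\sum_(i < d) v ord0 i ^+ 2).

Definition intvec (m : 'rV[int]_d) : 'rV[R]_d := map_mx intr m.

Definition thickening F (t : R) : set 'rV[R]_d :=
  [set v | (ereal_inf [set (euclidean_norm (v - w))%:E | w in F] <= t%:E)%E].

Definition expansive_set alpha F : Prop :=
  exists (delta t : R), [/\ 0 < delta, 0 <= t & forall x y : X,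
    (forall m : 'rV[int]_d, thickening F t (intvec m) ->
       mdist (alpha m x) (alpha m y) <= delta) -> x = y].

Definition line_through0 (L : set 'rV[R]_d) : Prop :=
  exists2 v : 'rV[R]_d, v != 0 & L = [set s *: v | s in [set: R]].

Definition expansive_locus alpha : set 'rV[R]_d :=
  (\bigcup_(L in [set L | line_through0 L /\ expansive_set alpha L]) L)
  `\` [set 0].

Definition expansive_component alpha (C : set 'rV[R]_d) : Prop :=
  exists2 v, expansive_locus alpha v &
    C = connected_component (expansive_locus alpha) v.

Definition Markov_component alpha (C : set 'rV[R]_d) : Prop :=
  expansive_component alpha C /\
  exists2 k : 'rV[int]_d, C (intvec k) & conjugate_to_SFT (alpha k).

Definition integral_points (C : set 'rV[R]_d) : set 'rV[int]_d :=
  intvec @^-1` C.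

Definition Lambda alpha C : set 'rV[int]_d := alpha @^-1` C.

End Components.
End Expansive.

(* Main.v *)
Require Import Defs.
From HB Require Import structures.
From mathcomp Require Import all_boot all_order all_algebra.
From mathcomp Require Import all_classical all_reals all_analysis.
From mathcomp Require Import ring lra zify.
Set Implicit Arguments.
Unset Strict Implicit.
Unset Printing Implicit Defensive.
Import Order.TTheory GRing.Theory Num.Theory.
Import numFieldNormedType.Exports.
Local Open Scope classical_set_scope.
Local Open Scope ring_scope.

(** Everything is read off from the half-spaces of Z^d. As soon as one line is
    expansive, X has a finite clopen partition c whose patterns along the whole
    action separate points. Call a unit vector w nondeterministic when the
    symbols at the lattice points k with k.w < 0 do not determine the symbol at
    0. These directions control both sides of the theorem.

    Components. A line R v is expansive exactly when v.w <> 0 for every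
    nondeterministic w ([expansive_locusE]). If v is orthogonal to w, the open
    half-space of w contains translates of every thickening of the line, so that
    closeness along the line does not determine the point.
    Conversely, if thick cylinders around the line fail to determine the point,
    a ball slid inside the cylinder until it meets a disagreement produces, in
    the limit of large radii, a nondeterministic direction orthogonal to v
    ([sliding], [line_determines]). The same argument with v = 0 and X infinite
    shows that nondeterministic directions exist. Hence the expansive locus is
    the complement of a union of hyperplanes, and u and v lie in the same
    component iff u.w and v.w have the same strict sign for every
    nondeterministic w ([component_same_side]). Since the nondeterministic
    directions form a compact set, components are open and contain lattice
    points ([component_integral]).

    Weakly LR automorphisms. Let alpha n and alpha m be expansive. If alpha m is
    essentially weakly LR for alpha n and some nondeterministic w separates n
    from m, two points that agree on the half-space of w agree on left rays of
    all rows of the space-time diagram, and further to the right the higher the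
    row. A right-resolving textile carries this agreement downwards, again and
    again, until the points agree everywhere, which is absurd
    ([textile_propagation]); the other sign is the same statement for the
    inverses, as turning a textile upside down exchanges left and right
    resolving. So n and m lie on the same side of every w. Conversely, let them
    do so. For a large ball B around 0, the patterns on B, n + B and n + m + B
    determine the pattern on m + B: move the ball straight from n to m; a point
    not reached would lie outside B and outside n + m + B, so that its direction
    would have nonnegative product with one point of the segment from n to m and
    nonpositive product with another ([parallelogram]). Exchanging n and m gives
    the mirror statement. These two implications say exactly that the square
    tiles with corner labels the B-patterns of x, alpha n x, alpha m x and
    alpha (n + m) x form a weakly LR textile ([weakly_LR_of_corners]).

    Markov components. For an expansive homeomorphism of a zero-dimensional
    compact metric space, being conjugate to a subshift of finite type and having
    the pseudo orbit tracing property are equivalent ([SFT_POTP], [POTP_SFT]), so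
    the two additional conditions on components and on cones agree. *)

(** * Locally constant maps and compactness *)

Definition locally_constant (T : topologicalType) (A : Type) (f : T -> A) :=
  forall x, \forall y \near x, f y = f x.

Section LocallyConstant.
Context {T U : topologicalType}.

Lemma locally_constant_comp (A : Type) (f : T -> A) (h : U -> T) :
  locally_constant f -> continuous h -> locally_constant (f \o h).
Proof. by move=> fl hc x; exact: (hc x _ (fl (h x))). Qed.

Lemma locally_constant_post (A B : Type) (f : T -> A) (g : A -> B) :
  locally_constant f -> locally_constant (g \o f).
Proof. by move=> fl x; apply: filterS (fl x) => y /= ->. Qed.

Lemma locally_constant_pair (A B : Type) (f : T -> A) (g : T -> B) :
  locally_constant f -> locally_constant g ->
  locally_constant (fun x => (f x, g x)).
Proof.
by move=> fl gl x; apply: filterS2 (fl x) (gl x) => y /= -> ->.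
Qed.

Lemma locally_constant_finfun (I : finType) (A : Type) (f : I -> T -> A) :
  (forall i, locally_constant (f i)) ->
  locally_constant (fun x => [ffun i => f i x]).
Proof.
move=> fl x; have fx : \forall y \near x, forall i, f i y = f i x.
  by apply: filter_forall => i; exact: fl.
by apply: filterS fx => y fy; apply/ffunP => i; rewrite !ffunE.
Qed.

Lemma clopen_locally_constant (V : set T) :
  clopen V -> locally_constant (fun x => `[< V x >]).
Proof.
move=> [oV cV] x; case: (pselect (V x)) => Vx.
  have xV : nbhs x V by apply: open_nbhs_nbhs; split.
  by apply: filterS xV => y Vy; rewrite !asboolT.
have xV : nbhs x (~` V).
  by apply: open_nbhs_nbhs; split => //; exact: closed_openC.
by apply: filterS xV => y Vy; rewrite !asboolF.
Qed.

Lemma locally_constant_near_neq (A : Type) (f : T -> A) (x y : T) :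
  locally_constant f -> f x <> f y ->
  \forall p \near (x, y), f p.1 <> f p.2.
Proof.
move=> fl fxy; exists ([set u | f u = f x], [set u | f u = f y]) => /=.
  by split; exact: fl.
by move=> [u v] /= [-> ->].
Qed.

Lemma locally_constant_near_eq (A : Type) (f : T -> A) (x y : T) :
  locally_constant f -> f x = f y ->
  \forall p \near (x, y), f p.1 = f p.2.
Proof.
move=> fl fxy; exists ([set u | f u = f x], [set u | f u = f y]) => /=.
  by split; exact: fl.
by move=> [u v] /= [-> ->].
Qed.

(** The form in which compactness enters: the hypothesis covers the compact
    square by an open set [O] and the open sets on which some [f i] separates
    the two points. *)
Lemma finite_separation (J : eqType) (A : J -> Type) (f : forall i, T -> A i)
    (P : J -> Prop) (O : set (T * T)) :
  compact [set: T] ->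
  (forall i, P i -> locally_constant (f i)) ->
  (forall x y, (forall i, P i -> f i x = f i y) -> \forall p \near (x, y), O p) ->
  exists2 s : seq J, (forall i, i \in s -> P i) &
    forall x y, (forall i, i \in s -> f i x = f i y) -> O (x, y).
Proof.
move=> cT fl sepO; have := compact_setX cT cT; rewrite setXTT.
move=> /compact_near_coveringP cTT.
pose B := [set s : seq J | forall i, i \in s -> P i].
pose W (s : seq J) := [set s' : seq J | {subset s <= s'} /\ B s'].
have FF : Filter (filter_from B W).
  apply: filter_from_filter; first by exists [::].
  move=> s s' Bs Bs'; exists (s ++ s').
    by move=> i; rewrite mem_cat => /orP[/Bs|/Bs'].
  move=> t [sub Bt]; split; split => // i im; apply: sub; rewrite mem_cat im //.
  by rewrite orbT.
pose Q (s : seq J) (p : T * T) :=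
  (forall i, i \in s -> f i p.1 = f i p.2) -> O p.
have [[x y] _|s Bs Ws] := cTT _ (filter_from B W) Q FF.
  have [/sepO Oxy|] := pselect (forall i, P i -> f i x = f i y).
    exists (O, setT) => /=; first by split => //; exact: filterT.
    by move=> [p s] [/= Op _] _.
  move=> /existsNP[i /not_implyP[Pi fi]].
  exists ([set p | f i p.1 <> f i p.2], W [:: i]) => /=.
    split; first exact: locally_constant_near_neq (fl _ Pi) fi.
    by exists [:: i] => // j; rewrite inE => /eqP ->.
  move=> [p s] [/= fp [sub _]] /(_ i) fe; case: fp; apply: fe; apply: sub.
  by rewrite inE.
exists s; first exact: Bs.
have WBs : W s s by split.
by move=> x y; exact: (Ws s WBs (x, y) I).
Qed.

End LocallyConstant.

Section CompactMetric.
Context {R : realType} {X : metricType R}.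
Hypothesis compactX : compact [set: X].

Lemma near_mdist_lt (x y : X) (e : R) :
  mdist x y < e -> \forall p \near (x, y), mdist p.1 p.2 < e.
Proof.
move=> xye; pose r := (e - mdist x y) / 2.
have r0 : 0 < r by rewrite divr_gt0 // subr_gt0.
exists (ball x r, ball y r) => /=; first by split; exact: nbhsx_ballx.
move=> [u v] [/=]; rewrite !ballEmdist /= => xu yv.
have := metric_triangle u x v; have := metric_triangle x y v.
by rewrite (metric_sym u x); move: xu yv; rewrite /r; lra.
Qed.

Lemma near_mdist_gt (x y : X) (e : R) :
  e < mdist x y -> \forall p \near (x, y), e < mdist p.1 p.2.
Proof.
move=> xye; pose r := (mdist x y - e) / 2.
have r0 : 0 < r by rewrite divr_gt0 // subr_gt0.
exists (ball x r, ball y r) => /=; first by split; exact: nbhsx_ballx.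
move=> [u v] [/=]; rewrite !ballEmdist /= => xu yv.
have := metric_triangle x u y; have := metric_triangle u v y.
by rewrite (metric_sym v y); move: xu yv; rewrite /r; lra.
Qed.

Lemma locally_constant_uniform (A : Type) (f : X -> A) :
  locally_constant f ->
  exists2 e : R, 0 < e & forall x y, mdist x y <= e -> f x = f y.
Proof.
move=> fl; apply: contrapT => nex.
have cXX : compact [set: X * X] by rewrite -setXTT; exact: compact_setX.
move: cXX => /compact_near_coveringP.
move=> /(_ R (0^'+) (fun e p => mdist p.1 p.2 <= e -> f p.1 = f p.2) _) [].
  move=> [x y] _; have [->|/eqP xy] := pselect (x = y).
    exists ([set p | f p.1 = f p.2], setT) => /=; last by case=> ? ? [].
    split; last exact: filterT.
    exact: locally_constant_near_eq.
  have d0 : 0 < mdist x y by rewrite mdist_gt0.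
  have d2 : mdist x y / 2 < mdist x y by rewrite ltr_pdivrMr // ltr_pMr // ltr1n.
  exists ([set p | mdist x y / 2 < mdist p.1 p.2], [set e | e < mdist x y / 2]).
    split => /=; first exact: near_mdist_gt.
    by apply: nbhs_right_lt; rewrite divr_gt0.
  move=> [p e] [/= h1 h2] h3; have := lt_trans h2 h1.
  by rewrite ltNge h3.
move=> e /= e0 he; apply: nex; exists (e / 2); first by rewrite divr_gt0.
move=> x y xy; apply: (he (e / 2) _ _ (x, y)) => //=; last by rewrite divr_gt0.
by rewrite sub0r normrN gtr0_norm ?divr_gt0 // ltr_pdivrMr // ltr_pMr // ltr1n.
Qed.

(** The clopen sets separate points, so finitely many of them have a joint
    partition of small mesh. *)
Lemma zero_dimensional_mesh (e : R) : zero_dimensional X -> 0 < e ->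
  exists (A : finType) (c : X -> A), locally_constant c /\
    forall x y, c x = c y -> mdist x y < e.
Proof.
move=> zX e0.
have [||s sclopen hs] := @finite_separation X (set X) _
  (fun V x => `[< V x >]) clopen [set p | mdist p.1 p.2 < e] compactX.
- by move=> V; exact: clopen_locally_constant.
- move=> x y h; apply: near_mdist_lt.
  suff -> : x = y by rewrite mdistxx.
  apply/eqP/negPn/negP => /zX[V [cV Vx Vy]].
  by have := h _ cV; rewrite asboolT // asboolF.
- exists {ffun 'I_(size s) -> bool}, (fun x => [ffun i => `[< tnth (in_tuple s) i x >]]).
  split.
    apply: locally_constant_finfun => i; apply: clopen_locally_constant.
    by apply: sclopen; exact: mem_tnth.
  move=> x y /ffunP h; apply: (hs x y) => V /(tnthP (in_tuple s))[i ->].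
  by have := h i; rewrite !ffunE.
Qed.

End CompactMetric.

(** * Integer powers and actions of Z^d *)

Section IntegerPowers.
Context {G : groupType}.
Implicit Types x y : G.

Lemma expgz1 x : expgz x 1 = x. Proof. by rewrite /expgz /= expg1. Qed.

Lemma expgzS x (j : int) : expgz x (j + 1) = (expgz x j * x)%g.
Proof.
case: j => [k|[|k]].
- have -> : Posz k + 1 = Posz k.+1 by lia.
  by rewrite /= expgSr.
- by rewrite /= expg1 mulVg.
- have -> : Negz k.+1 + 1 = Negz k by lia.
  by rewrite /= (expgS x k.+1) invgM mulgVK.
Qed.

Lemma expgz_unique x (f : int -> G) :
  f 0 = 1%g -> (forall j, f (j + 1) = (f j * x)%g) -> forall j, f j = expgz x j.
Proof.
move=> f0 fS; elim/int_rect => [//|n IH|n IH].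
  by rewrite -addn1 PoszD fS expgzS IH.
apply: (mulIg x); rewrite -fS -expgzS.
by have -> : - n.+1%:Z + 1 = - n%:Z by lia.
Qed.

Lemma expgzD x (i j : int) : expgz x (i + j) = (expgz x i * expgz x j)%g.
Proof.
suff h : forall k, ((expgz x i)^-1 * expgz x (i + k))%g = expgz x k.
  by rewrite -(h j) mulVKg.
apply: (@expgz_unique x (fun k => ((expgz x i)^-1 * expgz x (i + k))%g)).
  by rewrite addr0 mulVg.
by move=> k; rewrite addrA expgzS mulgA.
Qed.

Lemma commute_expgz x y (j : int) : commute x y -> commute x (expgz y j).
Proof.
by move=> xy; case: j => k; [|apply: commuteV]; exact: commuteX.
Qed.

Lemma expgz_commute x (i j : int) : commute (expgz x i) (expgz x j).
Proof. by rewrite /commute -!expgzD addrC. Qed.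

Lemma expgzV x (j : int) : expgz x^-1%g j = expgz x (- j).
Proof.
apply/esym; apply: (@expgz_unique _ (fun j => expgz x (- j))) => [//|k].
by apply: (mulIg x); rewrite mulgVK -expgzS opprD subrK.
Qed.

Lemma expgz_in (H : set G) x (j : int) : is_subgroup H -> H x -> H (expgz x j).
Proof.
move=> [H1 HM HV] Hx; have HX n : H (x ^+ n)%g.
  by elim: n => // n IH; rewrite expgS; exact: HM.
by case: j => k; [|apply: HV]; exact: HX.
Qed.

Section Action.
Context {d : nat} (psi : 'I_d -> G).
Hypothesis psiC : forall i j, commute (psi i) (psi j).
Implicit Types m n : 'rV[int]_d.

Lemma Zd_actionD m n :
  Zd_action psi (m + n) = (Zd_action psi m * Zd_action psi n)%g.
Proof.
rewrite /Zd_action -prodgM_commute.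
  by apply: eq_bigr => i _; rewrite mxE expgzD.
move=> i j _ _; apply: commute_expgz; apply: commute_sym.
by apply: commute_expgz.
Qed.

Lemma Zd_action0 : Zd_action psi 0 = 1%g.
Proof. by rewrite /Zd_action big1 // => i _; rewrite mxE. Qed.

Lemma Zd_action_delta i : Zd_action psi (delta_mx ord0 i) = psi i.
Proof.
rewrite /Zd_action -[RHS](big_pred1_eq *%g i psi) [RHS]big_mkcond /=.
by apply: eq_bigr => j _; rewrite mxE eqxx /=; case: eqP => // _; exact: expgz1.
Qed.

Lemma Zd_actionN n : (Zd_action psi n)^-1%g = Zd_action psi (- n).
Proof.
apply: (mulgI (Zd_action psi n)).
by rewrite mulgV -Zd_actionD subrr Zd_action0.
Qed.

Lemma generated_subgroup_range :
  generated_subgroup (range psi) = range (Zd_action psi).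
Proof.
apply/seteqP; split.
  apply: smallest_sub; first split.
  - by exists 0 => //; exact: Zd_action0.
  - by move=> _ _ [m _ <-] [n _ <-]; exists (m + n) => //; exact: Zd_actionD.
  - by move=> _ [m _ <-]; exists (- m) => //; rewrite Zd_actionN.
  by move=> _ [i _ <-]; exists (delta_mx ord0 i) => //; exact: Zd_action_delta.
move=> _ [m _ <-] H [subH psiH]; have [H1 HM _] := subH.
apply: (big_ind H) => // i _; apply: expgz_in => //; apply: psiH.
by exists i.
Qed.

End Action.
End IntegerPowers.

(** * Symbolic codings of a single homeomorphism *)

Section Fullshift.
Context {A : finType}.

Lemma coordinate_locally_constant (j : int) :
  locally_constant (fun y : fullshift A => y j : A).
Proof.
move=> y; have h := @proj_continuous int (fun=> discrete_topology A) j y.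
exact: (h _ (@discrete_set1 (discrete_topology A) (y j))).
Qed.

Lemma continuous_fullshift (T : topologicalType) (f : T -> fullshift A) :
  (forall j, locally_constant (fun x => f x j : A)) -> continuous f.
Proof.
move=> fl x; apply/cvg_sup => j; apply/cvg_image.
  by rewrite -subTset => a _; exists (fun=> a).
move=> W /nbhs_singleton Wfx; exists [set y : fullshift A | W (y j)].
  by apply: filterS (fl j x) => z /= ->.
by apply/seteqP; split => [_ [y Wy <-] //|a Wa]; exists (fun=> a).
Qed.

Lemma fullshift_hausdorff : hausdorff_space (fullshift A).
Proof.
apply: hausdorff_product => j; exact: discrete_hausdorff.
Qed.

Lemma closed_fullshift_compact (Y : set (fullshift A)) : closed Y -> compact Y.
Proof.
move=> cY; apply: (subclosed_compact cY (B := setT)) => //.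
have := @tychonoff int (fun=> discrete_topology A) (fun=> setT).
rewrite (_ : [set _ | _] = setT); last by apply/seteqP; split.
by apply=> j; apply: finite_compact; exact: finite_finset.
Qed.

End Fullshift.

Lemma homeoM (T : topologicalType) (f g : homeo T) x : (f * g)%g x = f (g x).
Proof. by []. Qed.

Lemma expgz_homeoS (T : topologicalType) (tau : homeo T) (j : int) x :
  expgz tau (j + 1) x = expgz tau j (tau x).
Proof. by rewrite expgzS. Qed.

Lemma expgz_homeoD (T : topologicalType) (tau : homeo T) (i j : int) x :
  expgz tau (i + j) x = expgz tau i (expgz tau j x).
Proof. by rewrite expgzD. Qed.

Section Itinerary.
Context {T : topologicalType}.
Variables (tau : homeo T) (A : finType) (c : T -> A).

Definition itinerary (x : T) : fullshift A := fun j => c (expgz tau j x).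

Definition generator := forall x y : T,
  (forall j, c (expgz tau j x) = c (expgz tau j y)) -> x = y.

Lemma itinerary_shift x : itinerary (tau x) = shift_map (itinerary x).
Proof. by apply/funext => j; rewrite /shift_map /itinerary expgz_homeoS. Qed.

Lemma itinerary_continuous : locally_constant c -> continuous itinerary.
Proof.
move=> cl; apply: continuous_fullshift => j.
by apply: locally_constant_comp cl _; exact: homeo_continuous.
Qed.

Lemma generator_inj : generator -> injective itinerary.
Proof. by move=> gen x y /(congr1 (@^~ _)) h; apply: gen => j; exact: h. Qed.

End Itinerary.

Section CompactCoding.
Context {T : topologicalType}.
Hypothesis compactT : compact [set: T].

(** A continuous injection of a compact space into a Hausdorff space is closed,
    so its inverse is continuous on the range; [x0] is the value of the inverse
    outside. *)
Lemma compact_homeo_onto (A : finType) (theta : T -> fullshift A) :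
  [set: T] !=set0 -> continuous theta -> injective theta ->
  homeo_onto theta (range theta).
Proof.
move=> [x0 _] thetac thetaI.
pose theta' y := xget x0 [set x | theta x = y].
have thetaK : cancel theta theta'.
  move=> x; apply: thetaI.
  by have := @xgetPex _ x0 [set u | theta u = theta x] (ex_intro _ x erefl).
exists theta'; split => //; last by move=> _ [x _ <-]; rewrite thetaK.
apply/subspace_continuousP => _ [x _ <-] W.
rewrite /from_subspace thetaK nbhsE => -[V [oV Vx] VW].
have cV : closed (theta @` (~` V)).
  apply: compact_closed; first exact: fullshift_hausdorff.
  apply: continuous_compact; first exact: continuous_subspaceT.
  exact: (subclosed_compact (open_closedC oV) compactT).
have nV : nbhs (theta x) (~` (theta @` (~` V))).
  apply: open_nbhs_nbhs; split; first exact: closed_openC.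
  by move=> [u nVu /thetaI ux]; apply: nVu; rewrite ux.
rewrite nbhs_simpl /=; apply: filterS nV => _ /[swap] -[u _ <-] nVu.
rewrite /= thetaK; apply: VW; apply: contrapT => nV; apply: nVu; by exists u.
Qed.

Lemma itinerary_conjugacy (tau : homeo T) (A : finType) (c : T -> A) :
  [set: T] !=set0 -> locally_constant c -> generator tau c ->
  conjugacy tau (range (itinerary tau c)) (itinerary tau c).
Proof.
move=> T0 cl gen; split; last exact: itinerary_shift.
apply: compact_homeo_onto => //; first exact: itinerary_continuous.
exact: generator_inj.
Qed.

Lemma itinerary_subshift (tau : homeo T) (A : finType) (c : T -> A) :
  locally_constant c -> subshift (range (itinerary tau c)).
Proof.
move=> cl; split.
  apply: compact_closed; first exact: fullshift_hausdorff.
  apply: continuous_compact => //.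
  by apply: continuous_subspaceT; exact: itinerary_continuous.
apply/seteqP; split => [_ [_ [x _ <-] <-]|_ [x _ <-]].
  by exists (tau x) => //; rewrite itinerary_shift.
exists (itinerary tau c (homeo_inv tau x)); first by eexists.
by rewrite -itinerary_shift homeo_invK.
Qed.

End CompactCoding.

Section Conjugacy.
Context {T : topologicalType} (tau : homeo T).
Variables (A : finType) (Y : set (fullshift A)) (theta : T -> fullshift A).
Hypothesis conj : conjugacy tau Y theta.

Lemma conjugacy_continuous : continuous theta.
Proof. by have [[? []]] := conj. Qed.

Lemma conjugacy_inj : injective theta.
Proof. by have [[? [_ _ _ /can_inj]]] := conj. Qed.

Lemma conjugacy_range : range theta = Y.
Proof.
have [[theta' [_ _ thY _ thK]] _] := conj.
apply/seteqP; split => [_ [x _ <-] //|y Yy].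
by exists (theta' y) => //; exact: thK.
Qed.

Lemma conjugacy_itinerary (j : int) x : theta x j = theta (expgz tau j x) 0.
Proof.
have h i u : theta (tau u) i = theta u (i + 1) by have [_ ->] := conj.
elim/int_rect: j x => [//|n IH|n IH] x.
  by rewrite -addn1 PoszD -h IH -expgz_homeoS.
have e : - n.+1%:Z + 1 = - n%:Z by lia.
by rewrite -{1 2}(homeo_invK tau x) h -expgz_homeoS e IH.
Qed.

Lemma conjugacy_locally_constant (j : int) :
  locally_constant (fun x => theta x j : A).
Proof.
have h := @locally_constant_comp _ _ _ _ _ (@coordinate_locally_constant A j).
exact: h conjugacy_continuous.
Qed.

Lemma conjugacy_generator : generator tau (fun x => theta x 0 : A).
Proof.
move=> x y h; apply: conjugacy_inj; apply/funext => j.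
by rewrite (conjugacy_itinerary j x) (conjugacy_itinerary j y) h.
Qed.

End Conjugacy.

(** * Shadowing and subshifts of finite type *)

Section Shadowing.
Context {R : realType} {X : metricType R}.
Hypothesis compactX : compact [set: X].
Implicit Types tau : homeo X.

Lemma generator_window tau (A : finType) (c : X -> A) (e : R) :
  locally_constant c -> generator tau c -> 0 < e ->
  exists M : nat, forall x y,
    (forall j : int, (`|j| <= M)%N -> c (expgz tau j x) = c (expgz tau j y)) ->
    mdist x y < e.
Proof.
move=> cl gen e0.
have [||s _ hs] := @finite_separation X int (fun=> A)
  (fun j x => c (expgz tau j x)) (fun=> True) [set p | mdist p.1 p.2 < e] compactX.
- by move=> j _; apply: locally_constant_comp cl _; exact: homeo_continuous.
- by move=> x y h; apply: near_mdist_lt; rewrite (gen x y) ?mdistxx // => j; exact: h.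
exists (\max_(j <- s) `|j|%N)%N => x y h; apply: (hs x y) => j js; apply: h.
by rewrite (big_rem j) //= leq_maxl.
Qed.

Lemma blockE (A : finType) (x y : fullshift A) (i i' : int) (n : nat) :
  (forall k : nat, (k < n)%N -> x (i + k%:Z) = y (i' + k%:Z)) ->
  block x i n = block y i' n.
Proof.
move=> h; apply/eq_in_map => k; rewrite mem_iota add0n => /andP[_ kn].
exact: h.
Qed.

Lemma block_eq (A : finType) (x y : fullshift A) (i i' : int) (n : nat) :
  block x i n = block y i' n ->
  forall k : nat, (k < n)%N -> x (i + k%:Z) = y (i' + k%:Z).
Proof.
move=> /eq_in_map h k kn; apply: h.
by rewrite mem_iota add0n.
Qed.

(** A pseudo-orbit of small jump size has symbolic itineraries that overlap on
    long windows, so their central symbols form a point of the subshift. *)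
Lemma SFT_POTP tau : conjugate_to_SFT tau -> POTP tau.
Proof.
move=> [A [Y [theta [[F YF] conj]]]] eps eps0.
pose c x : A := theta x 0.
have cl : locally_constant c := conjugacy_locally_constant conj 0.
have gen : generator tau c := conjugacy_generator conj.
have [M hM] := generator_window cl gen eps0.
pose W := maxn M (\max_(w <- F) size w)%N.
have [e e0 he] := locally_constant_uniform compactX
  (locally_constant_finfun (fun i : 'I_(W + W).+1 =>
     conjugacy_locally_constant conj (i%:Z - W%:Z))).
exists e => // x' px'.
have step (i j : int) : (`|j| <= W)%N -> theta (x' i) (j + 1) = theta (x' (i + 1)) j.
  move=> jW; have -> : theta (x' i) (j + 1) = theta (tau (x' i)) j.
    by have [_ ->] := conj.
  have := he _ _ (px' i) => /ffunP.
  have ltk : (`|(j + W%:Z)%R| < (W + W).+1)%N by lia.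
  move=> /(_ (Ordinal ltk)); rewrite !ffunE /=.
  by have -> : `|(j + W%:Z)%R|%:Z - W%:Z = j by lia.
have window (i j : int) : (`|j| <= W)%N -> theta (x' i) j = theta (x' (i + j)) 0.
  elim/int_rect: j i => [i _|n IH i nW|n IH i nW]; first by rewrite addr0.
    rewrite -addn1 PoszD step; last by lia.
    by rewrite IH; [rewrite addrAC addrA|lia].
  have -> : i = i - 1 + 1 by rewrite subrK.
  rewrite -step // (_ : - n.+1%:Z + 1 = - n%:Z); last by lia.
  rewrite IH; last by lia.
  by congr (theta (x' _) _); lia.
pose y : fullshift A := fun i => theta (x' i) 0.
have Yy : Y y.
  rewrite YF => i w wF; rewrite (@blockE _ y (theta (x' i)) i 0); last first.
    move=> k kw; rewrite add0r window //.
    have : (size w <= W)%N.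
      by rewrite leq_max; apply/orP; right; rewrite (big_rem w) //= leq_maxl.
    by move=> ?; apply: leq_trans (ltnW kw) _.
  have : Y (theta (x' i)) by rewrite -(conjugacy_range conj); exists (x' i).
  by rewrite YF => /(_ 0 w wF).
move: (Yy); rewrite -(conjugacy_range conj) => -[x _ xy].
exists (fun i => expgz tau i x).
  by move=> i; rewrite expgz_homeoS -homeoM (expgz_commute tau i 1) expgz1.
move=> i; apply: hM => j jM; rewrite -expgz_homeoD /c.
rewrite -!(conjugacy_itinerary conj) xy window; first by rewrite addrC.
by rewrite (leq_trans jM) // leq_maxl.
Qed.

(** The words of length [2M + 2] that do not occur are forbidden: a sequence
    avoiding them picks, position by position, a pseudo-orbit, and the orbit
    tracing it has the given itinerary. *)
Lemma POTP_SFT tau : zero_dimensional X -> [set: X] !=set0 ->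
  expansive tau -> POTP tau -> conjugate_to_SFT tau.
Proof.
move=> zX X0 [delta delta0 exp] potp.
have [A [c [cl cmesh]]] := zero_dimensional_mesh compactX zX delta0.
have gen : generator tau c.
  by move=> x y h; apply: exp => j; apply/ltW/cmesh; exact: h.
have [eps eps0 ceps] := locally_constant_uniform compactX cl.
have [del del0 trace] := potp _ eps0.
have [M hM] := generator_window cl gen del0.
pose N := (M + M).+2.
pose occurs (w : seq A) := exists x i, block (itinerary tau c x) i N = w.
exists A, (range (itinerary tau c)), (itinerary tau c).
split; last exact: itinerary_conjugacy.
exists [seq tval t | t : N.-tuple A <- enum {: N.-tuple A} & ~~ `[< occurs t >]].
apply/seteqP; split => [_ [x _ <-] i w /mapP[t]|y hy].
  rewrite mem_filter => /andP[/asboolPn nocc _] ->; apply/eqP => h.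
  by apply: nocc; exists x, i; rewrite -[N in LHS](size_tuple t).
have occ i : exists u, forall j : int, - (M%:Z) <= j <= M%:Z + 1 ->
    y (i + j) = itinerary tau c u j.
  have : occurs (block y (i - M%:Z) N).
    have sz : size (block y (i - M%:Z) N) == N by rewrite size_map size_iota.
    apply: contrapT => nocc; have := hy (i - M%:Z) (block y (i - M%:Z) N).
    have -> : size (block y (i - M%:Z) N) = N by exact/eqP.
    rewrite eqxx => /(_ _)/negP; apply; last by [].
    apply/mapP; exists (Tuple sz) => //; rewrite mem_filter mem_enum andbT.
    exact/asboolPn.
  move=> [x [i' h]]; exists (expgz tau (i' + M%:Z) x) => j /andP[j1 j2].
  have [k jk] : exists k : nat, j = k%:Z - M%:Z by exists (absz (j + M%:Z)); lia.
  have kN : (k < N)%N by rewrite /N; lia.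
  have := block_eq h kN; rewrite jk /itinerary -expgz_homeoD addrA.
  have -> : i + k%:Z - M%:Z = i - M%:Z + k%:Z by lia.
  move=> <-; congr (c (expgz tau _ x)); lia.
have [u hu] := choice occ.
have [i|x xo xtr] := trace u.
  apply/ltW/hM => j jM; have := hu (i + 1) j.
  rewrite /itinerary => <-; last by lia.
  rewrite -expgz_homeoS.
  have := hu i (j + 1); rewrite /itinerary => <-; last by lia.
  by congr y; lia.
have xE i : x i = expgz tau i (x 0).
  elim/int_rect: i => [//|n IH|n IH].
    by rewrite -addn1 PoszD xo IH -homeoM -[X in (X * _)%g](expgz1 tau) -expgzD addrC.
  have := xo (- n.+1%:Z); have -> : - n.+1%:Z + 1 = - n%:Z by lia.
  rewrite IH (_ : - n%:Z = 1 + - n.+1%:Z); last by lia.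
  by rewrite expgz_homeoD expgz1 => /(can_inj (@homeo_funK _ tau)) ->.
exists (x 0) => //; apply/funext => i; rewrite /itinerary -xE.
rewrite (ceps (x i) (u i)); last exact/ltW/xtr.
by have := hu i 0; rewrite addr0 => -> //; lia.
Qed.

End Shadowing.

(** * Weakly LR automorphisms and Wang tilings *)

Section Textile.
Context {T : topologicalType}.
Implicit Types tau psi : homeo T.

(** What a weakly LR textile says inside the space: [b x] is the arc over the
    origin of the row of [x], so that [b] is a generator whose bottom symbol
    [p (b x)] codes [x] and whose top symbol [q (b x)] codes [psi x]. *)
Definition textile_coding tau psi := exists (A B V : finType) (b : T -> B)
    (i t : B -> V) (p q : B -> A),
  [/\ locally_constant b, generator tau (p \o b),
      (forall x, p (b (psi x)) = q (b x)) & forall x, t (b x) = i (b (tau x))] /\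
  injective (fun s => (t s, p s)) /\ injective (fun s => (i s, q s)).

Lemma locally_constant_closed_fibres (A : finType) (f : T -> A) :
  (forall a, closed (f @^-1` [set a])) -> locally_constant f.
Proof.
move=> fcl x; have h : \forall y \near x, forall a, a != f x -> f y <> a.
  apply: filter_forall => a; have [->|afx] := eqVneq a (f x).
    by apply: filterE => y.
  have : nbhs x (~` (f @^-1` [set a])).
    apply: open_nbhs_nbhs; split; first exact: closed_openC.
    by move=> /= xa; rewrite xa eqxx in afx.
  by apply: filterS => y /= ya _.
by apply: filterS h => y /(_ (f y)) fy; apply/eqP/negPn/negP => /fy.
Qed.

(** The arc over the origin depends continuously on the point because the
    inverse of an injective continuous map on the compact set [Z] is
    continuous. *)
Lemma weakly_LR_textile_coding tau psi :
  essentially_weakly_LR tau psi -> textile_coding tau psi.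
Proof.
move=> [psitau [A [Y [phi [theta [subY [_ WLR] conj thpsi]]]]]].
have [B [Gamma [G [p [q [Z [[pL qR] [[[cZ sZ] Zpath pinj] [pZ qZ phiE]]]]]]]]] := WLR.
have ex x : exists z, Z z /\ Defs.path_map p z = theta x.
  have : Y (theta x) by rewrite -(conjugacy_range conj); exists x.
  by rewrite -pZ => -[z Zz zx]; exists z.
have [z hz] := choice ex.
have Zz x : Z (z x) by have [] := hz x.
have pz x : Defs.path_map p (z x) = theta x by have [] := hz x.
have zS x : z (tau x) = shift_map (z x).
  apply: pinj; rewrite ?inE //; first by rewrite -sZ; exists (z x).
  rewrite pz; have [_ ->] := conj; rewrite -pz.
  by [].
exists A, B, (vertex Gamma), (fun x => z x 0 : B), (initial Gamma),
  (terminal Gamma), (arc_map p), (arc_map q); split; last by split.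
have pb : arc_map p \o (fun x => z x 0 : B) = fun x => theta x 0 : A.
  by apply/funext => x /=; rewrite -(pz x).
split.
- apply: locally_constant_closed_fibres => s.
  pose Zs := Z `&` [set y | y 0 = s].
  have -> : (fun x => z x 0 : B) @^-1` [set s] = theta @^-1` (Defs.path_map p @` Zs).
    apply/seteqP; split => [x /= zxs|x /= [y [Zy ys] py]].
      by exists (z x) => //; split.
    by rewrite -(pinj y (z x)) ?inE // pz.
  apply: closed_comp; first by move=> x _; exact: conjugacy_continuous conj x.
  apply: compact_closed; first exact: fullshift_hausdorff.
  apply: continuous_compact.
    apply: continuous_subspaceT; apply: continuous_fullshift => j.
    exact: locally_constant_post (@coordinate_locally_constant B j).
  apply: closed_fullshift_compact; apply: closedI => //.
  rewrite -openC; rewrite openE => y /= ys.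
  have := @coordinate_locally_constant B 0 y.
  by apply: filterS => y' /= -> .
- by rewrite pb; exact: conjugacy_generator conj.
- move=> x /=; have := pz (psi x); rewrite thpsi -(pz x) phiE // => /(congr1 (@^~ 0)).
  by [].
- by move=> x; rewrite zS; have := Zpath _ (Zz x) 0.
Qed.

(** Reading a textile upside down exchanges the two resolving conditions. *)
Lemma textile_coding_inv tau psi : commute psi tau ->
  textile_coding tau psi -> textile_coding tau^-1%g psi^-1%g.
Proof.
move=> psitau [A [B [V [b [i [t [p [q [[bl gen pq ti] [pI qI]]]]]]]]]].
have qp u : q (b (psi^-1%g u)) = p (b u) by rewrite -pq -homeoM mulgV.
exists A, B, V, (b \o (psi^-1)%g), t, i, q, p; split; last by split.
split.
- by apply: locally_constant_comp bl _; exact: homeo_continuous.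
- by move=> x y h; apply: gen => j; have := h (- j); rewrite -expgzV invgK /= !qp.
- by move=> x /=; rewrite qp.
- move=> x; change (i (b (psi^-1%g x)) = t (b ((psi^-1 * tau^-1)%g x))).
  have -> : (psi^-1 * tau^-1)%g = (tau^-1 * psi^-1)%g by rewrite -!invgM psitau.
  by rewrite ti -homeoM mulVKg.
Qed.

End Textile.

(** In the space-time diagrams [u] and [v], with rows [k] and columns [j],
    agreement on the half-plane [k * mu + j * nu < kappa] spreads: far to the
    left the arcs of row [k] agree, and from there a right-resolving textile
    transports the agreement rightwards as far as row [k + 1] agrees. So the
    half-plane grows by [- mu] over and over. *)
Lemma textile_propagation (T : topologicalType) (R : realType)
    (tau psi : homeo T) (A B V : finType) (b : T -> B) (i t : B -> V)
    (p q : B -> A) (u v : int -> int -> T) (mu nu kappa : R) :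
  generator tau (p \o b) -> (forall x, p (b (psi x)) = q (b x)) ->
  (forall x, t (b x) = i (b (tau x))) -> injective (fun s => (i s, q s)) ->
  (forall w, w = u \/ w = v -> forall k j,
     w k (j + 1) = tau (w k j) /\ w (k + 1) j = psi (w k j)) ->
  mu < 0 -> 0 < nu ->
  (forall k j : int, k%:~R * mu + j%:~R * nu < kappa -> b (u k j) = b (v k j)) ->
  u 0 0 = v 0 0.
Proof.
move=> gen pq ti qI step mu0 nu0 agree.
have [us vs] := (step u (or_introl erefl), step v (or_intror erefl)).
have spread (e : nat) (k j : int) :
    k%:~R * mu + e%:R * mu + j%:~R * nu < kappa -> b (u k j) = b (v k j).
  elim: e k j => [|e IH] k j; first by rewrite mul0r addr0; exact: agree.
  move=> kj; pose n := Num.bound (- mu / nu).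
  have hn : - mu < n%:R * nu.
    by rewrite -ltr_pdivrMr // archi_boundP // divr_ge0 ?oppr_ge0 // ltW.
  suff row (l : nat) : (l <= n)%N ->
      b (u k (j - n%:Z + l%:Z)) = b (v k (j - n%:Z + l%:Z)).
    by have := row n (leqnn n); rewrite subrK.
  elim: l => [_|l IHl ln].
    have -> : j - n%:Z + 0%:Z = j - n%:Z by lia.
    apply: IH; move: hn kj; rewrite intrB -[n%:Z%:~R]pmulrn -[e.+1%:R]natr1.
    lra.
  have -> : j - n%:Z + l.+1%:Z = j - n%:Z + l%:Z + 1 by lia.
  set j' := j - n%:Z + l%:Z.
  apply: qI; congr (_, _); rewrite -?pq.
    by have [-> _] := us k j'; have [-> _] := vs k j'; rewrite -!ti IHl // ltnW.
  have [_ <-] := us k (j' + 1); have [_ <-] := vs k (j' + 1).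
  rewrite (IH (k + 1) (j' + 1)) //.
  apply: le_lt_trans kj; rewrite -[e.+1]addn1 natrD intrD !mulrDl mul1r.
  have : (j' + 1)%:~R <= j%:~R :> R by rewrite ler_int /j'; lia.
  rewrite -(ler_pM2r nu0); lra.
have row k j : b (u k j) = b (v k j).
  pose r := (k%:~R * mu + j%:~R * nu - kappa) / - mu.
  pose e := Num.bound `|r|.
  have he : k%:~R * mu + j%:~R * nu - kappa < e%:R * - mu.
    rewrite -ltr_pdivrMr ?oppr_gt0 //.
    exact: le_lt_trans (ler_norm _) (archi_boundP (normr_ge0 _)).
  by apply: (spread e); lra.
have orbit w : w = u \/ w = v -> forall j, expgz tau j (w 0 0) = w 0 j.
  move=> /step ws; elim/int_rect => [//|j IH|j IH].
    rewrite -addn1 PoszD; have [-> _] := ws 0 j%:Z.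
    by rewrite -IH addrC expgz_homeoD expgz1.
  apply: (can_inj (@homeo_funK _ tau)).
  have e : tau (expgz tau (- j.+1%:Z) (w 0 0)) = expgz tau (- j%:Z) (w 0 0).
    have -> : - j%:Z = 1 + - j.+1%:Z by lia.
    by rewrite expgz_homeoD expgz1.
  have [w1 _] := ws 0 (- j.+1%:Z).
  rewrite e IH -w1; congr (w 0 _); lia.
by apply: gen => j /=; rewrite (orbit u) ?(orbit v) ?row; [|right|left].
Qed.

Section WangTiles.
Context {T : topologicalType}.
Hypothesis compactT : compact [set: T].
Variables (tau psi : homeo T) (A : finType) (c : T -> A).

(** The textile has the unit squares of the space-time diagram of [c] as arcs,
    their vertical sides as vertices, and their bottom and top sides as images
    under [p] and [q]; the graph [G] has a single vertex. *)
Lemma weakly_LR_of_corners :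
  [set: T] !=set0 -> commute psi tau -> locally_constant c -> generator tau c ->
  (forall x y, c x = c y -> c (tau x) = c (tau y) ->
     c (tau (psi x)) = c (tau (psi y)) -> c (psi x) = c (psi y)) ->
  (forall x y, c x = c y -> c (psi x) = c (psi y) ->
     c (tau (psi x)) = c (tau (psi y)) -> c (tau x) = c (tau y)) ->
  essentially_weakly_LR tau psi.
Proof.
move=> T0 psitau cl gen corner_psi corner_tau.
have psitauE x : psi (tau x) = tau (psi x) by rewrite -homeoM psitau.
pose square x := (c x, c (tau x), c (psi x), c (tau (psi x))).
pose occurs s := `[< exists x, s = square x >].
pose B := {s : A * A * A * A | occurs s}.
have occ x : occurs (square x) by apply/asboolP; exists x.
pose b x : B := exist occurs (square x) (occ x).
have cc (h : homeo T) : locally_constant (fun x => c (h x)).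
  by apply: locally_constant_comp cl _; exact: homeo_continuous.
have bl : locally_constant b.
  have sl : locally_constant square.
    apply: locally_constant_pair; last exact: (cc (tau * psi)%g).
    apply: locally_constant_pair; last exact: (cc psi).
    by apply: locally_constant_pair; last exact: (cc tau).
  by move=> x; apply: filterS (sl x) => y /= yx; exact: val_inj.
pose bottom (s : B) := ((val s).1.1.1, (val s).1.1.2).
pose top (s : B) := ((val s).1.2, (val s).2).
pose left (s : B) := ((val s).1.1.1, (val s).1.2).
pose right (s : B) := ((val s).1.1.2, (val s).2).
pose Gamma := @Graph B (A * A)%type left right.
pose G := @Graph (A * A)%type unit (fun=> tt) (fun=> tt).
pose p := @GraphHom B (A * A)%type Gamma G bottom (fun=> tt) (fun=> erefl) (fun=> erefl).
pose q := @GraphHom B (A * A)%type Gamma G top (fun=> tt) (fun=> erefl) (fun=> erefl).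
pose row x := (c x, c (tau x)).
have rowl : locally_constant row.
  by apply: locally_constant_pair => //; exact: cc.
have rowgen : generator tau row by move=> x y h; apply: gen => j; have [] := h j.
pose theta := itinerary tau row.
have conj : conjugacy tau (range theta) theta by exact: itinerary_conjugacy.
have [[theta' [thc th'c _ thK _]] thS] := conj.
pose phi := theta \o psi \o theta'.
have phiE x : phi (theta x) = theta (psi x) by rewrite /phi /= thK.
pose z := itinerary tau b.
have pz x : Defs.path_map p (z x) = theta x by [].
have tauX j x : expgz tau j (tau x) = tau (expgz tau j x).
  by rewrite -homeoM (expgz_commute tau j 1) expgz1.
have qz x : Defs.path_map q (z x) = theta (psi x).
  apply/funext => j; rewrite /theta /itinerary /row /top /Defs.path_map /=.
  have e : expgz tau j (psi x) = psi (expgz tau j x).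
    by rewrite -homeoM -(commute_expgz j psitau).
  by rewrite /top /= e.
split => //; exists (A * A)%type, (range theta), phi, theta; split => //.
- exact: itinerary_subshift.
- split.
    split.
    + move=> y; apply: (@continuous_comp (subspace (range theta)) T (fullshift _)
        theta' (theta \o psi)).
        exact: th'c.
      by apply: continuous_comp; [exact: homeo_continuous|exact: thc].
    + by move=> _ [_ [x _ <-] <-]; rewrite phiE; exists (psi x).
    + by move=> _ [x _ <-]; rewrite -thS !phiE psitauE thS.
  exists B, Gamma, G, p, q, (range z); split; last split.
  + split.
      move=> s s' [] /= s1 s2 s3 s4; apply: val_inj.
      move: s s' s1 s2 s3 s4.
      move=> [s /[dup] /asboolP[x ->] os] [s' /[dup] /asboolP[y ->] os'] /= *.
      by rewrite /square; congr (_, _, _, _) => //; exact: corner_psi.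
    move=> s s' [] /= s1 s2 s3 s4; apply: val_inj.
    move: s s' s1 s2 s3 s4.
      move=> [s /[dup] /asboolP[x ->] os] [s' /[dup] /asboolP[y ->] os'] /= *.
    by rewrite /square; congr (_, _, _, _) => //; exact: corner_tau.
  + split.
    * exact: itinerary_subshift.
    * move=> _ [x _ <-] j; rewrite /= /z /itinerary expgz_homeoS tauX.
      by rewrite /right /left /= psitauE.
    * move=> _ _ /[!inE] -[x _ <-] [y _ <-]; rewrite !pz => xy.
      by rewrite (generator_inj rowgen xy).
  + split.
    * by apply/seteqP; split => [_ [_ [x _ <-] <-]|_ [x _ <-]];
        [exists x|exists (z x)].
    * by move=> _ [_ [x _ <-] <-]; rewrite qz; exists (psi x).
    * by move=> _ [x _ <-]; rewrite pz qz phiE.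
Qed.

End WangTiles.

(** * Euclidean geometry of row vectors *)

Section Dot.
Context {R : realType} {d : nat}.
Implicit Types (u v w : 'rV[R]_d) (k m n : 'rV[int]_d) (a : R).

Definition dot u v : R := \sum_(i < d) u ord0 i * v ord0 i.

Lemma dotC u v : dot u v = dot v u.
Proof. by apply: eq_bigr => i _; rewrite mulrC. Qed.

Lemma dotDl u v w : dot (u + v) w = dot u w + dot v w.
Proof. by rewrite -big_split; apply: eq_bigr => i _; rewrite mxE mulrDl. Qed.

Lemma dotZl a u w : dot (a *: u) w = a * dot u w.
Proof. by rewrite mulr_sumr; apply: eq_bigr => i _; rewrite mxE mulrA. Qed.

Lemma dotDr u v w : dot w (u + v) = dot w u + dot w v.
Proof. by rewrite dotC dotDl !(dotC w). Qed.

Lemma dotZr a u w : dot w (a *: u) = a * dot w u.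
Proof. by rewrite dotC dotZl dotC. Qed.

Lemma dotNl u w : dot (- u) w = - dot u w.
Proof. by rewrite -scaleN1r dotZl mulN1r. Qed.

Lemma dotNr u w : dot w (- u) = - dot w u.
Proof. by rewrite dotC dotNl dotC. Qed.

Lemma dot0l w : dot 0 w = 0.
Proof. by rewrite -(scale0r 0) dotZl mul0r. Qed.

Definition dotE := (dotDl, dotDr, dotZl, dotZr, dotNl, dotNr).

Lemma dot_ge0 u : 0 <= dot u u.
Proof. by apply: sumr_ge0 => i _; rewrite -expr2 sqr_ge0. Qed.

Lemma dot_eq0 u : dot u u = 0 -> u = 0.
Proof.
move=> /eqP; rewrite psumr_eq0 => [|i _]; last by rewrite -expr2 sqr_ge0.
move=> /allP h; apply/rowP => i; have := h i (mem_index_enum i).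
by rewrite /= -expr2 sqrf_eq0 mxE => /eqP.
Qed.

Lemma coord_sqr_le_dot u i : u ord0 i ^+ 2 <= dot u u.
Proof.
rewrite /dot (bigD1 i) //= expr2 lerDl.
by apply: sumr_ge0 => j _; rewrite -expr2 sqr_ge0.
Qed.

Lemma dot_le_weighted a u v : 0 < a -> 2 * dot u v <= a * dot u u + a^-1 * dot v v.
Proof.
move=> a0; have := dot_ge0 (a *: u - v); rewrite !dotE (dotC v u) => h.
have : 0 <= a^-1 * (a * (a * dot u u) - 2 * a * dot u v + dot v v).
  by apply: mulr_ge0; [rewrite invr_ge0 ltW|lra].
have an0 : a != 0 by rewrite gt_eqF.
have -> : a^-1 * (a * (a * dot u u) - 2 * a * dot u v + dot v v)
    = a * dot u u - 2 * dot u v + a^-1 * dot v v by field.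
lra.
Qed.

Lemma dot_sum_le u v : dot (u + v) (u + v) <= 2 * dot u u + 2 * dot v v.
Proof. by have := dot_ge0 (u - v); rewrite !dotE; lra. Qed.

(** Cauchy-Schwarz against a unit vector *)
Lemma dot_unit_le u w a : dot w w = 1 -> 0 <= a -> dot u u <= a ^+ 2 ->
  dot u w <= a.
Proof.
move=> w1 a0 ua; have := dot_ge0 (u - dot u w *: w).
rewrite !dotE w1 (dotC w u) => h.
by rewrite leNgt; apply/negP => lt; nra.
Qed.

(** Division by zero makes the coefficient [0] when [v = 0], as it should. *)
Lemma orthogonal_projection v u : exists a, dot v (u - a *: v) = 0 /\
  forall a', dot (u - a *: v) (u - a *: v) <= dot (u - a' *: v) (u - a' *: v).
Proof.
exists (dot u v / dot v v); set a := _ / _.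
have [v0|v0] := eqVneq (dot v v) 0.
  by rewrite (dot_eq0 v0) dot0l; split => // a'; rewrite !scaler0.
have av : a * dot v v = dot u v by rewrite divfK.
have orth : dot v (u - a *: v) = 0 by rewrite !dotE av dotC subrr.
split => // a'.
have -> : u - a' *: v = (u - a *: v) + (a - a') *: v.
  by rewrite scalerBl addrA subrK.
move: (u - a *: v) orth => r orth.
set b := a - a'; have := mulr_ge0 (sqr_ge0 b) (dot_ge0 v).
rewrite expr2 dotDl !(dotDr, dotZl, dotZr) (dotC r v) orth; lra.
Qed.

Lemma euclidean_normE u : euclidean_norm u = Num.sqrt (dot u u).
Proof. by congr Num.sqrt; apply: eq_bigr => i _; rewrite expr2. Qed.

Lemma dot_continuous_of (f g : 'I_d -> 'rV[R]_d -> R) :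
  (forall i, continuous (f i)) -> (forall i, continuous (g i)) ->
  continuous (fun w => \sum_(i < d) f i w * g i w).
Proof.
move=> fc gc w.
apply: (@continuous_big R^o 'I_d +%R 0 xpredT (@add_continuous R^o) 'rV[R]_d
  (index_enum _) (fun i w => f i w * g i w)) => i _ {}w.
exact: (@cvgM R _ (nbhs w) _ (f i) (g i) _ _ (fc i w) (gc i w)).
Qed.

Lemma dot_continuous u : continuous (dot u).
Proof.
apply: (@dot_continuous_of (fun i _ => u ord0 i) (fun i w => w ord0 i)) => i w.
  exact: (@cvg_cst R^o (u ord0 i) _ (nbhs w)).
exact: coord_continuous.
Qed.
Lemma near_dot_lt u w a : dot u w < a -> \forall w' \near w, dot u w' < a.
Proof.
exact: (@cvgr_lt R _ (nbhs w) _ (dot u) (dot u w) (@dot_continuous u w)).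
Qed.

Lemma near_dot_gt u w a : a < dot u w -> \forall w' \near w, a < dot u w'.
Proof.
exact: (@cvgr_gt R _ (nbhs w) _ (dot u) (dot u w) (@dot_continuous u w)).
Qed.

Lemma near_dot_neq0 u w : dot u w != 0 -> \forall w' \near w, dot u w' != 0.
Proof.
rewrite neq_lt => /orP[/near_dot_lt|/near_dot_gt]; apply: filterS => w'.
  by move=> h; rewrite lt_eqF.
by move=> h; rewrite gt_eqF.
Qed.

Lemma intvecD m n : @intvec R d (m + n) = @intvec R d m + @intvec R d n.
Proof. by apply/rowP => i; rewrite !mxE intrD. Qed.

Lemma intvecN m : @intvec R d (- m) = - @intvec R d m.
Proof. by apply/rowP => i; rewrite !mxE intrN. Qed.

Lemma intvecZ m (j : int) : @intvec R d (m *~ j) = j%:~R *: @intvec R d m.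
Proof.
have e i : (m *~ j) ord0 i = m ord0 i * j.
  by rewrite -mulrzz; case: j => k; rewrite /intmul ?mxE mulmxnE.
by apply/rowP => i; rewrite !mxE e intrM mulrC.
Qed.

Lemma intvec0 : @intvec R d (0 : 'rV[int]_d) = 0.
Proof. by apply/rowP => i; rewrite !mxE. Qed.

Lemma intvec_dot_ge1 k : k != 0 -> 1 <= dot (@intvec R d k) (@intvec R d k).
Proof.
move=> /rV0Pn[i ki]; apply: le_trans (coord_sqr_le_dot _ i).
rewrite mxE expr2 -intrM -[1]/(1%:~R) ler_int.
have {}ki : k ord0 i <> 0 :> int by apply/eqP.
move: (k ord0 i : int) ki => z ki.
have [h|h] : z <= -1 \/ 1 <= z by lia.
  by nia.
by nia.
Qed.

Lemma finite_lattice_ball (r : R) :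
  finite_set [set k : 'rV[int]_d | dot (@intvec R d k) (@intvec R d k) <= r].
Proof.
pose M := Num.bound `|r|.
pose f (v : 'rV['I_(M + M).+1]_d) : 'rV[int]_d :=
  map_mx (fun i : 'I__ => i%:Z - M%:Z) v.
apply: (@sub_finite_set _ _ (range f)); last first.
  by apply: finite_image; exact: finite_finset.
move=> k /= kr; exists (\row_i inord (absz (k ord0 i + M%:Z))) => //.
apply/rowP => i; rewrite !mxE.
have ki : (k ord0 i) ^+ 2 <= M%:Z.
  rewrite -(ler_int R) expr2 intrM -expr2.
  apply: le_trans (ltW (archi_boundP (normr_ge0 r))).
  apply: le_trans (ler_norm r); apply: le_trans kr.
  by have := coord_sqr_le_dot (@intvec R d k) i; rewrite mxE.
move: (k ord0 i : int) ki => z; rewrite expr2 => ki.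
have [z1 z2] : - M%:Z <= z /\ z <= M%:Z by split; nia.
by rewrite inordK; lia.
Qed.

Lemma unit_sphere_compact : compact [set w | dot w w = 1].
Proof.
apply: bounded_closed_compact.
  exists 1; split => // a a1 w /= w1; apply: le_trans (ltW a1).
  rewrite [leLHS]/Num.norm /= mx_normrE; apply/bigmax_leP; split => // -[i j] _ /=.
  rewrite (ord1 i) -(ler_sqr (normr_ge0 _)) ?nnegrE // expr1n.
  by rewrite real_normK ?num_real // -w1; exact: coord_sqr_le_dot.
have -> : [set w | dot w w = 1] = (fun w => dot w w) @^-1` [set 1] by [].
apply: closed_comp; last exact: closed_eq.
move=> w _; move: w.
apply: (@dot_continuous_of (fun i w => w ord0 i) (fun i w => w ord0 i)) => i {}w;
  exact: coord_continuous.
Qed.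

Lemma thickening_dot F a u : thickening F a u ->
  exists2 w, F w & dot (u - w) (u - w) < (a + 1) ^+ 2.
Proof.
move=> h; have /ereal_inf_lt[_ [w Fw <-]] :
    (ereal_inf [set (euclidean_norm (u - w))%:E | w in F] < (a + 1)%:E)%E.
  by apply: le_lt_trans h _; rewrite lte_fin ltrDl.
rewrite lte_fin euclidean_normE => uw; exists w => //.
rewrite -[ltLHS]sqr_sqrtr ?dot_ge0 //.
have := sqrtr_ge0 (dot (u - w) (u - w)).
by move: uw; set z := Num.sqrt _ => uw z0; nra.
Qed.

Lemma dot_thickening (F : set 'rV[R]_d) a u w : 0 <= a -> F w ->
  dot (u - w) (u - w) <= a ^+ 2 -> thickening F a u.
Proof.
move=> a0 Fw uw; apply: ge_ereal_inf; exists (euclidean_norm (u - w))%:E.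
  by exists w.
by rewrite lee_fin euclidean_normE -(ger0_norm a0) -sqrtr_sqr ler_wsqrtr.
Qed.

Lemma lattice_direction w b : dot w w = 1 -> exists k, dot (intvec k) w < b.
Proof.
move=> w1; have [i wi] : exists i, w ord0 i != 0.
  apply/existsP; apply: contraPT w1 => /existsPn h.
  rewrite (_ : w = 0) ?dot0l; first by apply/eqP; rewrite eq_sym oner_eq0.
  by apply/rowP => i; have := h i; rewrite negbK mxE => /eqP.
pose N := Num.bound (`|b| / `|w ord0 i|).
pose e : int := if 0 < w ord0 i then -1 else 1.
exists (delta_mx ord0 i *~ (e * N%:Z)); rewrite intvecZ dotZl.
have -> : dot (intvec (delta_mx ord0 i)) w = w ord0 i.
  rewrite /dot (bigD1 i) //= big1 => [|j ji]; last first.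
    by rewrite !mxE (negbTE ji) andbF mul0r.
  by rewrite !mxE !eqxx mul1r addr0.
have wi0 : 0 < `|w ord0 i| by rewrite normr_gt0.
have hN : `|b| < N%:R * `|w ord0 i|.
  by rewrite -ltr_pdivrMr // archi_boundP // divr_ge0.
have -> : (e * N%:Z)%:~R * w ord0 i = - (N%:R * `|w ord0 i|).
  rewrite intrM mulrC mulrA /e -[N%:Z%:~R]pmulrn; case: ifP => [w0|/negbT].
    by rewrite gtr0_norm // mulrN1z; ring.
  by rewrite -leNgt => w0; rewrite ler0_norm // mulr1z; ring.
by have := ler_norm (- b); rewrite normrN; lra.
Qed.

End Dot.

(** * Deterministic half-spaces *)

(** The point added by a small move of a ball is still far from the centre. Here
    [rho] is its distance from the new centre, [e] bounds the squared length of
    the move, and [z] is the squared distance from the old centre. *)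
Lemma far_from_centre (R : realDomainType) (r j rho e z : R) :
  0 <= j -> 0 <= rho -> 16 * e <= 1 -> 4 * j + 1 <= r ->
  r ^+ 2 < z -> z <= 2 * rho ^+ 2 + 2 * e -> 2 * j <= rho /\ 0 < rho.
Proof.
move=> j0 rho0 e1 rj rz ze.
by split; rewrite ltNge || rewrite leNgt; apply/negP => h; nra.
Qed.

Section HalfSpaces.
Context {R : realType} {X : metricType R}.
Hypothesis compactX : compact [set: X].
Context {d : nat}.
Variable alpha : 'rV[int]_d -> homeo X.
Hypothesis alphaD : forall m n, alpha (m + n) = (alpha m * alpha n)%g.
Variables (A : finType) (c : X -> A).
Hypothesis cl : locally_constant c.
Implicit Types (u v w : 'rV[R]_d) (k m n : 'rV[int]_d) (x y : X).

Local Notation ivec := (@intvec R d).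

Lemma alpha_add m n x : alpha (m + n) x = alpha m (alpha n x).
Proof. by rewrite alphaD. Qed.

Lemma alpha_zero x : alpha 0 x = x.
Proof.
have -> : alpha 0 = 1%g by apply: (mulIg (alpha 0)); rewrite -alphaD addr0 mul1g.
by [].
Qed.

Lemma locally_constant_alpha k : locally_constant (fun x => c (alpha k x)).
Proof. by apply: locally_constant_comp cl _; exact: homeo_continuous. Qed.

Definition agree (S : set 'rV[int]_d) x y :=
  forall k, S k -> c (alpha k x) = c (alpha k y).

(** Failure of the symbol at [0] to be determined by an open half-space; the
    normal vector is normalized so that these directions form a compact set. *)
Definition nondeterministic w := dot w w = 1 /\ exists x y,
  agree [set k | dot (ivec k) w < 0] x y /\ c x <> c y.

(** Points of an open half-space lie in all large balls tangent to its boundary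
    at [0], and still do after a small tilt of the half-space. *)
Lemma near_half_space (s : seq 'rV[int]_d) w :
  (forall k, k \in s -> dot (ivec k) w < 0) ->
  exists V : set 'rV[R]_d, nbhs w V /\ exists N : nat, forall w' (j : nat),
    V w' -> (N <= j)%N -> forall k, k \in s ->
    dot (ivec k) (ivec k) + 2 * j%:R * dot (ivec k) w' < 0.
Proof.
elim: s => [_|k s IH h]; first by exists setT; split; [exact: filterT|exists 0].
have [|V [wV [N VN]]] := IH; first by move=> k' k's; apply: h; rewrite inE k's orbT.
have kw : dot (ivec k) w < 0 by apply: h; rewrite inE eqxx.
pose e := - dot (ivec k) w / 2; pose C := dot (ivec k) (ivec k).
have e0 : 0 < e by rewrite divr_gt0 // oppr_gt0.
pose V' := [set w' | dot (ivec k) w' < - e].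
have wV' : nbhs w V' by apply: near_dot_lt; rewrite /e; lra.
exists (V `&` V'); split; first exact: filterI.
exists (maxn N (Num.bound (C / e))).+1 => w' j [Vw' V'w'] jN k'.
have jN1 : (N <= j)%N by apply: leq_trans jN; rewrite leqW // leq_maxl.
rewrite inE => /orP[/eqP ->|]; last exact: VN.
have Cj : C / e < j%:R.
  have C0 : 0 <= C / e by rewrite divr_ge0 ?dot_ge0 // ltW.
  apply: lt_le_trans (archi_boundP C0) _; rewrite ler_nat.
  by apply: leq_trans jN; rewrite leqW // leq_maxr.
have Cej : C < j%:R * e by rewrite -ltr_pdivrMr.
have C0 : 0 <= C := dot_ge0 _.
have j0 : 0 <= j%:R :> R by [].
move: V'w'; rewrite /V' /= -/C; set a := dot _ _ => V'w'.
have : j%:R * a <= j%:R * - e by rewrite ler_wpM2l // ltW.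
lra.
Qed.

(** Balls of radius [j] tangent to [0] fill, as [j] grows, an open half-space;
    so the directions in which they fail to determine the symbol at [0]
    accumulate at a direction whose half-space fails as well. *)
Lemma sliding (w_ : nat -> 'rV[R]_d) (x_ y_ : nat -> X) :
  (forall j, dot (w_ j) (w_ j) = 1) ->
  (forall j, agree [set k | dot (ivec k) (ivec k)
       + 2 * j%:R * dot (ivec k) (w_ j) < 0] (x_ j) (y_ j)) ->
  (forall j, c (x_ j) <> c (y_ j)) ->
  exists2 w, nondeterministic w &
    forall V, nbhs w V -> forall N, exists2 j, (N <= j)%N & V (w_ j).
Proof.
move=> w1 ag neq.
have [w [ww wcl]] : [set w | dot w w = 1] `&` cluster (w_ @ \oo) !=set0.
  apply: unit_sphere_compact.
  by exists 0 => // j _ /=; rewrite w1.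
have rec V : nbhs w V -> forall N, exists2 j, (N <= j)%N & V (w_ j).
  move=> wV N; pose tail := [set w_ j | j in [set j | (N <= j)%N]].
  have [|_ [[j Nj <-] Vj]] := wcl tail V _ wV.
    by exists N => // j /= Nj; exists j.
  by exists j.
exists w => //; split => //; apply: contrapT => det.
have detw x y : agree [set k | dot (ivec k) w < 0] x y -> c x = c y.
  by move=> h; apply: contrapT => cxy; apply: det; exists x, y.
have [||s ss hs] := @finite_separation X 'rV[int]_d (fun=> A)
  (fun k x => c (alpha k x)) (fun k => dot (ivec k) w < 0)
  [set p | c p.1 = c p.2] compactX.
- by move=> k _; exact: locally_constant_alpha.
- by move=> x y /detw; exact: locally_constant_near_eq.
have [V [wV [N VN]]] := near_half_space ss.
have [j Nj Vj] := rec V wV N.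
by apply: (neq j); apply: hs => k ks; apply: ag; exact: VN Nj _ ks.
Qed.

(** The ball of radius [j] touching a ball of radius at least [2 * j] from inside
    at [a] has room to spare: as nonzero integral vectors have length at least
    [1], the squared distance to the centre drops by a definite amount, which
    pays for the approximate choice of the point [a]. *)
Lemma tangent_ball k (a w : 'rV[R]_d) (rho : R) (j : nat) :
  a = rho *: w -> 2 * j%:R <= rho ->
  dot (ivec k) (ivec k) + 2 * j%:R * dot (ivec k) w < 0 ->
  dot (ivec k + a) (ivec k + a) + 1 < dot a a.
Proof.
move=> -> jr h; have k0 : k != 0.
  by apply/eqP => k0; move: h; rewrite k0 intvec0 !dot0l mulr0 addr0 ltxx.
have k1 := @intvec_dot_ge1 R d k k0.
rewrite dotDl !(dotDr, dotZl, dotZr) (dotC w).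
move: h k1; set K := dot _ _; set b := dot _ w => h k1.
have j0 : 0 <= j%:R :> R by [].
have b0 : b < 0.
  rewrite ltNge; apply/negP => b0; have : 0 <= j%:R * b by rewrite mulr_ge0.
  lra.
have : rho * b <= 2 * j%:R * b by rewrite ler_wnM2r // ltW.
lra.
Qed.


Definition near_line v (t : nat) := [set k | exists a : R,
  dot (ivec k - a *: v) (ivec k - a *: v) <= t%:R ^+ 2].

(** Take two points that agree on a thick cylinder around the line, and a place
    of disagreement that is nearly closest to the axis. The ball that touches
    the cylinder through it from inside shows a direction orthogonal to [v]
    whose half-space is not determining. *)
Lemma line_determines v :
  (forall w, nondeterministic w -> dot v w != 0) ->
  exists t, forall x y, agree (near_line v t) x y -> agree setT x y.
Proof.
move=> vN; apply: contrapT => nex.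
have bad (j : nat) : exists p : 'rV[R]_d * X * X,
    [/\ dot p.1.1 p.1.1 = 1, dot v p.1.1 = 0, agree [set k |
      dot (ivec k) (ivec k) + 2 * j%:R * dot (ivec k) p.1.1 < 0] p.1.2 p.2
      & c p.1.2 <> c p.2].
  move/forallNP : nex => /(_ (2 * j)%N) /existsNP[x /existsNP[y]].
  move=> /not_implyP[ag /existsNP[k0 /not_implyP[_ k0neq]]].
  pose P (n : nat) := `[< exists k (a : R), c (alpha k x) <> c (alpha k y) /\
    dot (ivec k - a *: v) (ivec k - a *: v) < n%:R >].
  have exP : exists l : nat, P l.
    exists (Num.bound (dot (ivec k0 - 0 *: v) (ivec k0 - 0 *: v))).
    by apply/asboolP; exists k0, 0; split => //; apply: archi_boundP; exact: dot_ge0.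
  (* distances are only minimized up to [1], as the projections of lattice points
     to the orthogonal complement may accumulate *)
  case: (ex_minnP exP) => l /asboolP[k [a0 [kneq ka0]]] lmin.
  have [a [orth amin]] := orthogonal_projection v (ivec k).
  set r := ivec k - a *: v in orth amin.
  have rl : dot r r < l%:R by apply: le_lt_trans ka0; exact: amin.
  have jr : ((2 * j)%:R : R) ^+ 2 < dot r r.
    by rewrite ltNge; apply/negP => rj; apply: kneq; apply: ag; exists a.
  pose rho := Num.sqrt (dot r r).
  have rho2 : rho ^+ 2 = dot r r by rewrite sqr_sqrtr // dot_ge0.
  have rho_ge0 : 0 <= rho by exact: sqrtr_ge0.
  have jrho : 2 * j%:R < rho.
    have j0 : 0 <= j%:R :> R by [].
    move: jr; rewrite -rho2 natrM => jr; rewrite ltNge; apply/negP => rj.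
    by clear - jr rj j0 rho_ge0; nra.
  have rho0 : rho != 0 by rewrite gt_eqF // (le_lt_trans _ jrho).
  have rE : r = rho *: (rho^-1 *: r) by rewrite scalerA mulfV // scale1r.
  exists (rho^-1 *: r, alpha k x, alpha k y); split => //=.
  - by rewrite dotZl dotZr -rho2; field.
  - by rewrite dotZr orth mulr0.
  - move=> u /= /(tangent_ball rE (ltW jrho)) ur; apply: contrapT => uneq.
    case: l rl lmin {ka0} => [|l] rl lmin.
      by move: rl; rewrite ltNge dot_ge0.
    suff /lmin : P l by rewrite ltnn.
    apply/asboolP; exists (u + k), a; split; first by rewrite !alpha_add.
    rewrite intvecD -addrA -/r; move: rl ur; rewrite -natr1; clear; lra.
have [f hf] := choice bad.
have [|||w wN wcl] := @sliding (fun j => (f j).1.1)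
  (fun j => (f j).1.2) (fun j => (f j).2).
- by move=> j; have [] := hf j.
- by move=> j; have [] := hf j.
- by move=> j; have [] := hf j.
have [j _ /eqP] := wcl _ (near_dot_neq0 (vN _ wN)) 0%N; apply.
by have [] := hf j.
Qed.

Definition lattice_ball v (r : nat) :=
  [set k | dot (ivec k - v) (ivec k - v) <= r%:R ^+ 2].

Lemma ball_pattern (r : nat) : exists (B : finType) (b : X -> B),
  locally_constant b /\ forall x y, b x = b y <-> agree (lattice_ball 0 r) x y.
Proof.
have := @finite_lattice_ball R d (r%:R ^+ 2) => /finite_seqP[s sE].
exists {ffun 'I_(size s) -> A},
  (fun x => [ffun i => c (alpha (tnth (in_tuple s) i) x)]); split.
  by apply: locally_constant_finfun => i; exact: locally_constant_alpha.
have sP k : lattice_ball 0 r k <-> k \in s.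
  rewrite /lattice_ball /= subr0.
  by have : [set` s] k <-> k \in s by []; rewrite -sE.
move=> x y; split => [/ffunP h k|h].
  by rewrite sP => /(tnthP (in_tuple s))[i ->]; have := h i; rewrite !ffunE.
by apply/ffunP => i; rewrite !ffunE; apply: h; rewrite sP; exact: mem_tnth.
Qed.

Lemma agree_ball_alpha n (r : nat) x y :
  agree (lattice_ball 0 r) (alpha n x) (alpha n y) <->
  agree (lattice_ball (ivec n) r) x y.
Proof.
split=> h k /= kr.
  have := h (k - n); rewrite -!alpha_add subrK; apply.
  by rewrite /lattice_ball /= intvecD intvecN subr0.
rewrite -!alpha_add; apply: h.
by move: kr; rewrite /lattice_ball /= intvecD subr0 addrK.
Qed.

Hypothesis gen : forall x y, agree setT x y -> x = y.
Hypothesis infiniteX : infinite_set [set: X].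

(** If no direction failed, the case [v = 0] of [line_determines] would let the
    pattern on one ball determine the point, and a ball has finitely many
    patterns. *)
Lemma nondeterministic_ex : exists w, nondeterministic w.
Proof.
apply: contrapT => nex; have [|t ht] := @line_determines 0.
  by move=> w wN; case: nex; exists w.
have [B [b [_ bE]]] := ball_pattern t.
apply: infiniteX; rewrite -(preimage_setT b).
apply: finite_preimage; last exact: finite_finset.
move=> x y _ _ /bE ag; apply: gen; apply: ht => k [a].
by rewrite scaler0 => kt; apply: ag.
Qed.

(** A thickened line along [n] is covered by the balls of one radius around the
    integral multiples of [n]. *)
Lemma line_ball_generator n :
  (forall w, nondeterministic w -> dot (ivec n) w != 0) ->
  exists r0 : nat, forall r, (r0 <= r)%N -> forall x y,
    (forall j : int, agree (lattice_ball (ivec (n *~ j)) r) x y) -> x = y.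
Proof.
move=> /line_determines[t ht].
pose C := 2 * t%:R ^+ 2 + 2 * dot (ivec n) (ivec n).
exists (Num.bound `|C|) => r r0 x y h; apply: gen; apply: ht => k [a ka].
apply: (h (Num.floor a)); rewrite /lattice_ball /= intvecZ.
have -> : ivec k - (Num.floor a)%:~R *: ivec n =
    (ivec k - a *: ivec n) + (a - (Num.floor a)%:~R) *: ivec n.
  by rewrite scalerBl addrA subrK.
apply: le_trans (dot_sum_le _ _) _.
set e := a - _; have [e0 e1] : 0 <= e /\ e <= 1.
  have /andP[f1 f2] := floor_itv a.
  by move: f2; rewrite intrD subr_ge0 /e; split => //; lra.
have nn := dot_ge0 (ivec n).
have : dot (e *: ivec n) (e *: ivec n) <= dot (ivec n) (ivec n).
  by rewrite dotZl dotZr mulrA -[leRHS]mul1r ler_wpM2r //; nra.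
have Cr : C <= r%:R ^+ 2.
  apply: le_trans (ler_norm C) _; apply: le_trans (ltW (archi_boundP (normr_ge0 C))) _.
  rewrite -natrX ler_nat (leq_trans r0) // -{1}(muln1 r) expnS expn1.
  by case: (r) => // r'; rewrite leq_mul2l.
by move: Cr; rewrite /C; lra.
Qed.


Lemma alpha_expgz n (j : int) : expgz (alpha n) j = alpha (n *~ j).
Proof.
apply/esym; apply: (@expgz_unique _ _ (fun j => alpha (n *~ j))).
  by rewrite mulr0z; apply: homeo_eq => x; rewrite alpha_zero.
by move=> k; rewrite mulrzDr alphaD mulr1z.
Qed.

(** The half-space of a direction orthogonal to [v] contains a translate of any
    thickened line along [v], even with a margin [C] that lets closeness be read
    off from finitely many symbols. *)
Lemma expansive_set_deterministic v :
  expansive_set alpha [set a *: v | a in [set: R]] ->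
  forall w, nondeterministic w -> dot v w != 0.
Proof.
move=> [delta [t [delta0 t0 exp]]] w [w1 [x [y [xy cxy]]]].
apply/eqP => vw; apply: cxy; congr c.
have [||s _ hs] := @finite_separation X 'rV[int]_d (fun=> A)
  (fun k x => c (alpha k x)) (fun=> True)
  [set p | mdist p.1 p.2 < delta] compactX.
- by move=> k _; exact: locally_constant_alpha.
- move=> x' y' h; apply: near_mdist_lt.
  have -> : x' = y' by apply: gen => k _; exact: h.
  by rewrite mdistxx.
pose C := \sum_(k <- s) `|dot (ivec k) w|.
have [k0 hk0] := lattice_direction (- (C + t + 1)) w1.
suff : alpha k0 x = alpha k0 y by exact: (can_inj (@homeo_funK _ (alpha k0))).
apply: exp => m /thickening_dot[_ [a _ <-] mt]; apply/ltW/hs => k ks.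
rewrite -!alpha_add; apply: xy => /=; rewrite !intvecD !dotDl.
have kC : dot (ivec k) w <= C.
  rewrite /C (big_rem k) //=; apply: le_trans (ler_norm _) _.
  by rewrite lerDl sumr_ge0.
have mw : dot (ivec m) w <= t + 1.
  have := dot_unit_le w1 _ (ltW mt); rewrite dotDl dotNl dotZl vw mulr0 subr0.
  by apply; rewrite addr_ge0.
by move: hk0; lra.
Qed.

Lemma deterministic_expansive_set v :
  (forall w, nondeterministic w -> dot v w != 0) ->
  expansive_set alpha [set a *: v | a in [set: R]].
Proof.
move=> /line_determines[t ht].
have [e e0 ce] := locally_constant_uniform compactX cl.
exists e, t%:R; split => // x y h; apply: gen; apply: ht => k [a ka].
by apply: ce; apply: h; apply: dot_thickening ka => //; exists a.
Qed.

Lemma expansive_alphaE n :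
  expansive (alpha n) <-> forall w, nondeterministic w -> dot (ivec n) w != 0.
Proof.
split=> [[delta delta0 exp]|/line_ball_generator[r0 hr]].
  apply: expansive_set_deterministic; exists delta, 0; split => // x y h.
  apply: exp => j; rewrite alpha_expgz; apply: h.
  apply: (@dot_thickening _ _ _ _ _ (j%:~R *: ivec n)) => //.
  by rewrite intvecZ subrr dot0l expr0n.
have [B [b [bl bE]]] := ball_pattern r0.
have [e e0 be] := locally_constant_uniform compactX bl.
exists e => // x y h; apply: (hr _ (leqnn r0)) => j.
apply/agree_ball_alpha/bE/be; rewrite -alpha_expgz; exact: h.
Qed.

Lemma expansive_locusE v :
  expansive_locus alpha v <-> forall w, nondeterministic w -> dot v w != 0.
Proof.
split=> [[[_ [[u u0 ->] /expansive_set_deterministic uN]] [a _ <-]] av w /uN uw|vN].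
  rewrite dotZl mulf_neq0 //; apply/eqP => a0.
  by apply: av; rewrite /= a0 scale0r.
have v0 : v != 0.
  have [w /vN] := nondeterministic_ex; apply: contraNneq => ->.
  by rewrite dot0l.
split; last exact/eqP.
exists [set a *: v | a in [set: R]]; last by exists 1 => //; rewrite scale1r.
by split; [exists v|exact: deterministic_expansive_set].
Qed.


(** * Moving a ball across a parallelogram *)

Section Parallelogram.
Variables p q : 'rV[R]_d.
Hypothesis same_side : forall w, nondeterministic w -> 0 < dot p w * dot q w.

Let centre (a : R) := (1 - a) *: p + a *: q.
Let D := dot p p + dot q q.

Lemma centre_dot a : 0 <= a <= 1 -> dot (centre a) (centre a) <= D.
Proof.
move=> /andP[a0 a1]; rewrite /centre /D.
have -> : dot ((1 - a) *: p + a *: q) ((1 - a) *: p + a *: q) =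
    (1 - a) * dot p p + a * dot q q - a * (1 - a) * dot (p - q) (p - q).
  by rewrite !dotE (dotC q p); ring.
have h := dot_ge0 (p - q); have hp := dot_ge0 p; have hq := dot_ge0 q.
have : 0 <= a * (1 - a) * dot (p - q) (p - q) by rewrite !mulr_ge0 // subr_ge0.
have : (1 - a) * dot p p <= dot p p by rewrite ler_piMl //; lra.
have : a * dot q q <= dot q q by rewrite ler_piMl.
lra.
Qed.

Lemma centre_opposite a : p + q - centre a = centre (1 - a).
Proof.
rewrite /centre; apply/rowP => i; rewrite !mxE; ring.
Qed.

(** A ball may be moved from [p] towards [q] by small steps. A point that a step
    fails to reach lies outside the balls around [0] and [p + q], so its
    direction [w] from the centre has, in the limit, a nonnegative product with
    the centre and a nonpositive one with the opposite centre; these are two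
    points of the segment from [p] to [q], on which a failing direction has one
    strict sign. *)
Lemma ball_step : exists r0 : nat, forall r, (r0 <= r)%N ->
  forall a a', 0 <= a <= 1 ->
  16 * r%:R ^+ 2 * dot (centre a - centre a') (centre a - centre a') <= 1 ->
  forall x y, agree (lattice_ball 0 r) x y -> agree (lattice_ball (p + q) r) x y ->
  agree (lattice_ball (centre a') r) x y -> agree (lattice_ball (centre a) r) x y.
Proof.
apply: contrapT => nex.
have bad (j : nat) : exists f : 'rV[R]_d * X * X, [/\ dot f.1.1 f.1.1 = 1,
    agree [set k | dot (ivec k) (ivec k) + 2 * j%:R * dot (ivec k) f.1.1 < 0]
      f.1.2 f.2, c f.1.2 <> c f.2 & exists2 a, 0 <= a <= 1 &
    - D <= 4 * j%:R * dot f.1.1 (centre a) /\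
    4 * j%:R * dot f.1.1 (centre (1 - a)) <= D].
  move/forallNP : nex => /(_ (4 * j).+1).
  move=> /existsNP[r /not_implyP[jr /existsNP[a /existsNP[a']]]].
  move=> /not_implyP[a01 /not_implyP[aa' /existsNP[x /existsNP[y]]]].
  move=> /not_implyP[ag0 /not_implyP[agpq /not_implyP[aga' /existsNP[k]]]].
  move=> /not_implyP[kr kneq].
  have out u : agree (lattice_ball u r) x y ->
      r%:R ^+ 2 < dot (ivec k - u) (ivec k - u).
    by move=> ag; rewrite ltNge; apply/negP => ku; exact/kneq/ag.
  have j0 : 0 <= j%:R :> R by [].
  have rj : 4 * j%:R + 1 <= r%:R :> R by rewrite -natrM natr1 ler_nat.
  have [s sdef] : exists s, s = ivec k - centre a by exists (ivec k - centre a).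
  have [e edef] : exists e, e = centre a - centre a' by exists (centre a - centre a').
  rewrite -edef in aa'.
  have sE : ivec k - centre a' = s + e by rewrite sdef edef addrA subrK.
  have kr' : dot s s <= r%:R ^+ 2 by rewrite sdef.
  have se : r%:R ^+ 2 < dot (s + e) (s + e) by rewrite -sE; exact: out.
  have e0 := dot_ge0 e; have s0 := dot_ge0 s.
  have e1 : dot e e <= 1 / 16.
    have : 1 * dot e e <= r%:R ^+ 2 * dot e e by apply: ler_wpM2r => //; nra.
    by lra.
  pose rho := Num.sqrt (dot s s).
  have rho2 : rho ^+ 2 = dot s s by rewrite sqr_sqrtr.
  have rho_ge0 : 0 <= rho by exact: sqrtr_ge0.
  have [jrho rho_gt0] : 2 * j%:R <= rho /\ 0 < rho.
    apply: (far_from_centre (e := dot e e) j0 rho_ge0 _ rj se); last first.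
      by rewrite rho2 dot_sum_le.
    by lra.
  have rho_neq0 : rho != 0 by rewrite gt_eqF.
  pose w := rho^-1 *: s.
  have sw : s = rho *: w by rewrite scalerA mulfV // scale1r.
  have kE : ivec k = s + centre a by rewrite sdef subrK.
  (* a point farther from [centre a - u] than from [centre a] lies on the side
     of [u], up to an error that is small for large balls *)
  have side u : dot (ivec k - centre a) (ivec k - centre a) < dot (s + u) (s + u) ->
      - dot u u <= 4 * j%:R * dot w u.
    rewrite -sdef dotDl !dotDr (dotC u s).
    have -> : dot s u = rho * dot w u by rewrite /w dotZl mulrA mulfV // mul1r.
    move=> h.
    have : 0 < 2 * rho * dot w u + dot u u by lra.
    have := dot_ge0 u; case: (lerP 0 (dot w u)) => wu u0 hh.
      by have := mulr_ge0 j0 wu; lra.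
    have : 2 * rho * dot w u <= 2 * (2 * j%:R) * dot w u.
      by rewrite ler_wnM2r ?(ltW wu) //; lra.
    lra.
  exists (w, alpha k x, alpha k y); split => //=.
  - by rewrite /w dotZl dotZr -rho2; field.
  - move=> u /= /(tangent_ball sw jrho) us; rewrite -!alpha_add; apply: aga'.
    rewrite /lattice_ball /= intvecD -addrA sE addrA.
    have [b bdef] : exists b, b = ivec u + s by exists (ivec u + s).
    rewrite -bdef in us *.
    pose r2 : R := r%:R ^+ 2.
    have r1 : 1 <= r2 by rewrite /r2; nra.
    have r20 : r2 != 0 by rewrite gt_eqF // (lt_le_trans ltr01).
    have c0 : 0 < (4 * r2)^-1 by rewrite invr_gt0; lra.
    have := dot_le_weighted b e c0; rewrite invrK => h.
    have : (4 * r2)^-1 * dot b b <= 1 / 4.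
      have : dot b b <= r2 by rewrite /r2; lra.
      move=> bb; have -> : 1 / 4 = (4 * r2)^-1 * r2 by field.
      by rewrite ler_wpM2l // ltW.
    have : 16 * r2 * dot e e <= 1 by exact: aa'.
    rewrite dotDl !dotDr (dotC e b) -/r2 => h1 h2.
    have : dot b b < r2 - 1 by rewrite /r2; lra.
    by lra.
  - exists a => //; split.
      apply: le_trans (side (centre a) _); first by rewrite lerN2 centre_dot.
      rewrite -kE -sdef; apply: le_lt_trans kr' _.
      by have := out 0 ag0; rewrite subr0.
    have := side (- centre (1 - a)); rewrite !dotNr !dotNl opprK => h.
    suff : - dot (centre (1 - a)) (centre (1 - a)) <= 4 * j%:R * - dot w (centre (1 - a)).
      have : dot (centre (1 - a)) (centre (1 - a)) <= D.
        by apply: centre_dot; move: a01 => /andP[? ?]; apply/andP; split; lra.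
      lra.
    apply: h; rewrite -sdef; apply: le_lt_trans kr' _.
    have := out _ agpq; rewrite -centre_opposite.
    have -> // : s - (p + q - centre a) = ivec k - (p + q).
    by rewrite sdef opprB addrA subrK.
have [f hf] := choice bad.
have [|||w wN wcl] := @sliding (fun j => (f j).1.1)
  (fun j => (f j).1.2) (fun j => (f j).2).
- by move=> j; have [] := hf j.
- by move=> j; have [] := hf j.
- by move=> j; have [] := hf j.
have D0 : 0 <= D by rewrite addr_ge0 ?dot_ge0.
have far (e : R) : 0 < e -> exists N : nat, forall j : nat, (N <= j)%N ->
    D < 4 * j%:R * e.
  move=> e0; exists (Num.bound (D / e)) => j jN.
  have : D < j%:R * e.
    rewrite -ltr_pdivrMr //; apply: lt_le_trans (archi_boundP _) _.
      by rewrite divr_ge0 // ltW.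
    by rewrite ler_nat.
  have : 0 <= j%:R * e by rewrite mulr_ge0 // ltW.
  by lra.
have conv (e z1 z2 a : R) : 0 <= a <= 1 -> e < z1 -> e < z2 ->
    e < (1 - a) * z1 + a * z2.
  move=> /andP[a0 a1] h1 h2.
  have h3 : 0 <= a * (z2 - e) by rewrite mulr_ge0 // subr_ge0 ltW.
  have [a_lt1|a_ge1] := ltrP a 1.
    have : 0 < (1 - a) * (z1 - e) by rewrite mulr_gt0 // subr_gt0.
    by lra.
  have -> : a = 1 by apply/eqP; rewrite eq_le a1.
  by lra.
have := same_side wN; case: (ltrgtP (dot p w) 0) => pw; last by rewrite pw mul0r ltxx.
- rewrite nmulr_rgt0 // => qw.
  pose e := Num.min (- dot p w) (- dot q w) / 2.
  have e0 : 0 < e by rewrite divr_gt0 // lt_min !oppr_gt0 pw.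
  have ep : dot p w < - e.
    have : Num.min (- dot p w) (- dot q w) <= - dot p w by rewrite ge_min lexx.
    by rewrite /e; rewrite /e in e0; lra.
  have eq : dot q w < - e.
    have : Num.min (- dot p w) (- dot q w) <= - dot q w by rewrite ge_min lexx orbT.
    by rewrite /e; rewrite /e in e0; lra.
  have [N hN] := far _ e0.
  have [j jN [pj qj]] := wcl _ (filterI (near_dot_lt ep) (near_dot_lt eq)) N.
  have [_ _ _ [a a01 [h _]]] := hf j.
  have := conv e (- dot p (f j).1.1) (- dot q (f j).1.1) a a01.
  rewrite ltrNr => /(_ pj); rewrite ltrNr => /(_ qj) he.
  move: h; rewrite /centre dotDr !dotZr !(dotC (f j).1.1) => h.
  have := hN j jN; have : 0 <= j%:R :> R by [].
  set z := (1 - a) * dot p _ + _ in h *.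
  have {}he : e < - z by rewrite /z; lra.
  move=> j0 hD; have : j%:R * e <= j%:R * - z by rewrite ler_wpM2l // ltW.
  by lra.
- rewrite pmulr_rgt0 // => qw.
  pose e := Num.min (dot p w) (dot q w) / 2.
  have e0 : 0 < e by rewrite divr_gt0 // lt_min pw.
  have ep : e < dot p w.
    have : Num.min (dot p w) (dot q w) <= dot p w by rewrite ge_min lexx.
    by rewrite /e; rewrite /e in e0; lra.
  have eq : e < dot q w.
    have : Num.min (dot p w) (dot q w) <= dot q w by rewrite ge_min lexx orbT.
    by rewrite /e; rewrite /e in e0; lra.
  have [N hN] := far _ e0.
  have [j jN [pj qj]] := wcl _ (filterI (near_dot_gt ep) (near_dot_gt eq)) N.
  have [_ _ _ [a /andP[a0 a1] [_ h]]] := hf j.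
  have a01 : 0 <= 1 - a <= 1 by apply/andP; split; lra.
  have he := conv e (dot p (f j).1.1) (dot q (f j).1.1) (1 - a) a01 pj qj.
  move: h; rewrite /centre dotDr !dotZr !(dotC (f j).1.1) => h.
  have := hN j jN; have j0 : 0 <= j%:R :> R by [].
  set z := (1 - (1 - a)) * dot p _ + _ in h he *.
  have : j%:R * e <= j%:R * z by rewrite ler_wpM2l // ltW.
  by lra.
Qed.

Lemma parallelogram : exists r0 : nat, forall r, (r0 <= r)%N -> forall x y,
  agree (lattice_ball 0 r) x y -> agree (lattice_ball (p + q) r) x y ->
  agree (lattice_ball p r) x y -> agree (lattice_ball q r) x y.
Proof.
have [r0 hr] := ball_step; exists r0 => r /hr step x y ag0 agpq agp.
pose C := 16 * r%:R ^+ 2 * dot (q - p) (q - p).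
have C0 : 0 <= C by rewrite mulr_ge0 ?dot_ge0 // mulr_ge0 // sqr_ge0.
pose N := (Num.bound C).+1.
have N0 : 0 < N%:R :> R by rewrite ltr0n.
have CN : C <= N%:R ^+ 2.
  apply: le_trans (ltW (archi_boundP C0)) _; rewrite -natrX ler_nat.
  by rewrite /N expnS expn1; nia.
have chain (i : nat) : (i <= N)%N -> agree (lattice_ball (centre (i%:R / N%:R)) r) x y.
  elim: i => [_|i IH iN].
    by rewrite /centre mul0r subr0 scale1r scale0r addr0.
  apply: (step _ (i%:R / N%:R)) => //; last exact/IH/ltnW.
    by rewrite divr_ge0 //= ler_pdivrMr // mul1r ler_nat.
  have -> : centre (i.+1%:R / N%:R) - centre (i%:R / N%:R) = N%:R^-1 *: (q - p).
    have Nn0 : N%:R != 0 :> R by rewrite gt_eqF.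
    by rewrite /centre; apply/rowP => l; rewrite !mxE -natr1; field.
  rewrite dotZl dotZr.
  have -> : 16 * r%:R ^+ 2 * (N%:R^-1 * (N%:R^-1 * dot (q - p) (q - p))) =
      C / N%:R ^+ 2.
    by rewrite /C; field; rewrite gt_eqF.
  by rewrite ler_pdivrMr ?exprn_gt0 // mul1r.
have := chain N (leqnn N).
by rewrite /centre divff ?gt_eqF // subrr scale0r scale1r add0r.
Qed.

End Parallelogram.

(** * Weakly LR automorphisms and sides of half-spaces *)

Lemma alpha_inv n : (alpha n)^-1%g = alpha (- n).
Proof.
apply: (mulgI (alpha n)); rewrite mulgV -alphaD subrr.
by apply: homeo_eq => x; rewrite alpha_zero.
Qed.

Lemma alpha_commute m n : commute (alpha m) (alpha n).
Proof. by rewrite /commute -!alphaD addrC. Qed.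

(** Two points that agree on the half-space of [w] agree, up to a constant
    margin, on a half-plane of their space-time diagrams. *)
Lemma textile_not_opposite n m w :
  textile_coding (alpha n) (alpha m) -> nondeterministic w ->
  0 < dot (ivec n) w -> ~ dot (ivec m) w < 0.
Proof.
move=> [A' [B [V [b [i [t [p [q [[bl bgen pq ti] [_ qI]]]]]]]]]].
move=> [w1 [x [y [xy cxy]]]] nw mw.
have [||s _ hs] := @finite_separation X 'rV[int]_d (fun=> A)
  (fun k x => c (alpha k x)) (fun=> True) [set z | b z.1 = b z.2] compactX.
- by move=> k _; exact: locally_constant_alpha.
- move=> x' y' h; have -> : x' = y' by apply: gen => k _; exact: h.
  exact: locally_constant_near_eq.
pose C := \sum_(k <- s) `|dot (ivec k) w|.
pose diagram x (k j : int) := alpha (m *~ k + n *~ j) x.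
have step z (k j : int) : diagram z k (j + 1) = alpha n (diagram z k j) /\
    diagram z (k + 1) j = alpha m (diagram z k j).
  rewrite /diagram -!alpha_add !mulrzDr !mulr1z; split.
    by rewrite addrA addrC.
  by rewrite addrAC addrC.
suff : diagram x 0 0 = diagram y 0 0.
  by rewrite /diagram !mulr0z addr0 !alpha_zero => xy'; apply: cxy; rewrite xy'.
apply: (@textile_propagation X R (alpha n) (alpha m) A' B V b i t p q
  (diagram x) (diagram y) (dot (ivec m) w) (dot (ivec n) w) (- C)) => //.
  by move=> _ [->|->].
move=> k j kj; apply: hs => l ls; rewrite -!alpha_add; apply: xy => /=.
rewrite !intvecD !intvecZ !dotDl !dotZl.
have lC : dot (ivec l) w <= C.
  rewrite /C (big_rem l) //=; apply: le_trans (ler_norm _) _.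
  by rewrite lerDl sumr_ge0.
by lra.
Qed.

Lemma LR_same_side n m w : essentially_weakly_LR (alpha n) (alpha m) ->
  nondeterministic w -> dot (ivec n) w != 0 -> dot (ivec m) w != 0 ->
  0 < dot (ivec n) w * dot (ivec m) w.
Proof.
move=> /weakly_LR_textile_coding cod wN.
have inv := textile_coding_inv (alpha_commute m n) cod.
rewrite !neq_lt => /orP[] n0 /orP[] m0.
- by rewrite nmulr_rgt0.
- rewrite !alpha_inv in inv; have := textile_not_opposite inv wN.
  by rewrite !intvecN !dotNl oppr_gt0 oppr_lt0 => /(_ n0).
- by have := textile_not_opposite cod wN n0.
- by rewrite pmulr_rgt0.
Qed.

(** The corner labels are the patterns on a ball large enough for the two
    parallelograms with sides [n], [m] and for generating under [alpha n]. *)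
Lemma same_side_LR n m :
  (forall w, nondeterministic w -> 0 < dot (ivec n) w * dot (ivec m) w) ->
  essentially_weakly_LR (alpha n) (alpha m).
Proof.
move=> side.
have [r1 h1] := parallelogram side.
have side' w : nondeterministic w -> 0 < dot (ivec m) w * dot (ivec n) w.
  by move=> /side; rewrite mulrC.
have [r2 h2] := parallelogram side'.
have [|r3 h3] := @line_ball_generator n.
  by move=> w /side; apply: contraTneq => ->; rewrite mul0r ltxx.
pose r := maxn r1 (maxn r2 r3).
have [rr1 rr2 rr3] : [/\ r1 <= r, r2 <= r & r3 <= r]%N.
  by rewrite /r !leq_max !leqnn !orbT.
have [B [b [bl bE]]] := ball_pattern r.
have bnE k x y : b (alpha k x) = b (alpha k y) <-> agree (lattice_ball (ivec k) r) x y.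
  by rewrite bE agree_ball_alpha.
have b0E x y : b x = b y <-> agree (lattice_ball 0 r) x y := bE x y.
apply: (@weakly_LR_of_corners X compactX (alpha n) (alpha m) B b) => //.
- apply: contrapT => /set0P/negP; rewrite negbK => /eqP X0.
  by apply: infiniteX; rewrite X0.
- exact: alpha_commute.
- move=> x y h; apply: (h3 r rr3) => j; apply/bnE; rewrite -alpha_expgz; exact: h.
- move=> x y /b0E h0 /bnE hn; rewrite -!alpha_add => /bnE; rewrite intvecD => hnm.
  by apply/bnE; apply: (h1 r rr1).
- move=> x y /b0E h0 /bnE hm; rewrite -!alpha_add => /bnE; rewrite intvecD addrC => hnm.
  by apply/bnE; apply: (h2 r rr2).
Qed.

(** * Components of the expansive locus *)

Local Notation locus := (expansive_locus alpha).

(** On a connected part of the locus a nondeterministic direction keeps its sign;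
    conversely, points with equal signs are joined by a segment of the locus. *)
Lemma component_same_side u v : locus u ->
  connected_component locus u v <->
  forall w, nondeterministic w -> 0 < dot u w * dot v w.
Proof.
move=> uE; split=> [uv w wN|side].
  have nz z : connected_component locus u z -> dot z w != 0.
    by move=> /connected_component_sub/expansive_locusE; exact.
  have uu := connected_component_refl uE.
  pose P := [set z | 0 < dot (dot u w *: w) z].
  have PE z : P z <-> 0 < dot u w * dot z w by rewrite /P /= dotZl (dotC w).
  have h : connected_component locus u `&` P = connected_component locus u.
    apply: (@component_connected _ locus u).
    - exists u; split => //; apply/PE; rewrite -expr2 exprn_even_gt0 //.
      by rewrite nz.
    - exists P => //; rewrite openE => z; exact: near_dot_gt.
    - exists [set z | 0 <= dot (dot u w *: w) z].
        rewrite -openC openE => z /= /negP; rewrite -ltNge => /near_dot_lt.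
        by apply: filterS => z' z'0; apply/negP; rewrite -ltNge.
      apply/seteqP; split=> z [zC]; first by move=> /ltW.
      rewrite /= le_eqVlt => /orP[/eqP z0|]; last by [].
      move: z0; rewrite dotZl (dotC w) => /esym/eqP.
      by rewrite mulf_eq0 !(negbTE (nz _ _)).
  by move: uv; rewrite -h => -[_ /PE].
have segc : connected [set (1 - a) *: u + a *: v | a in `[0, 1]%classic].
  apply: connected_continuous_connected; first exact: segment_connected.
  apply: continuous_subspaceT => a.
  have -> : (fun b => (1 - b) *: u + b *: v) = (fun b : R => u + b *: (v - u)).
    by apply/funext => b; rewrite scalerBl scale1r scalerBr addrA addrAC.
  by apply: cvgD; [exact: cvg_cst|apply: cvgZr_tmp; exact: cvg_id].
apply: (connected_component_max _ _ segc).
- exists 0; first by rewrite /= in_itv /= lexx ler01.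
  by rewrite subr0 scale1r scale0r addr0.
- move=> _ [a /= +] <-; rewrite in_itv /= => /andP[a0 a1].
  apply/expansive_locusE => w wN; have := side w wN.
  have /expansive_locusE/(_ w wN) := uE.
  rewrite dotDl !dotZl; move: (dot u w) (dot v w) => z1 z2 z10 z12.
  apply/eqP => h; have : z1 * ((1 - a) * z1 + a * z2) = 0 by rewrite h mulr0.
  have z11 : 0 < z1 * z1 by rewrite -expr2 exprn_even_gt0.
  move=> h2; have : (1 - a) * (z1 * z1) + a * (z1 * z2) = 0 by rewrite -h2; ring.
  have [a_lt1|a_ge1] := ltrP a 1.
    have : 0 < (1 - a) * (z1 * z1) by rewrite mulr_gt0 // subr_gt0.
    have : 0 <= a * (z1 * z2) by rewrite mulr_ge0 // ltW.
    by lra.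
  have -> : a = 1 by apply/eqP; rewrite eq_le a1.
  by lra.
- exists 1; first by rewrite /= in_itv /= lexx ler01.
  by rewrite subrr scale0r scale1r add0r.
Qed.

(** Lattice points near [j *: v] eventually enter the component of [v], because
    the failing directions form a compact set. *)
Lemma component_integral v : locus v ->
  exists k, connected_component locus v (ivec k).
Proof.
move=> vE; apply: contrapT => nex.
pose z j : 'rV[int]_d := \row_i Num.floor (j%:R * v ord0 i).
pose D : R := d%:R + 1.
have D0 : 0 <= D by rewrite addr_ge0.
have zv (j : nat) : exists2 e, ivec (z j) = j%:R *: v + e & dot e e <= D ^+ 2.
  exists (ivec (z j) - j%:R *: v); first by rewrite addrC subrK.
  have : dot (ivec (z j) - j%:R *: v) (ivec (z j) - j%:R *: v) <= \sum_(i < d) 1.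
    apply: ler_sum => i _; rewrite !mxE.
    have /andP[h1 h2] := floor_itv (j%:R * v ord0 i).
    have {}h2 : j%:R * v ord0 i < (Num.floor (j%:R * v ord0 i))%:~R + 1.
      by move: h2; rewrite intrD.
    by rewrite -[leRHS](mulr1 1); nra.
  rewrite sumr_const card_ord => /le_trans; apply; rewrite /D.
  have : 0 <= d%:R :> R by []; by nra.
have bad (j : nat) : exists f : 'rV[R]_d * X * X, [/\ dot f.1.1 f.1.1 = 1,
    agree [set k | dot (ivec k) f.1.1 < 0] f.1.2 f.2, c f.1.2 <> c f.2 &
    dot v f.1.1 * dot (ivec (z j)) f.1.1 <= 0].
  move/forallNP : nex => /(_ (z j)); rewrite component_same_side //.
  move=> /existsNP[w /not_implyP[[w1 [x [y [xy cxy]]]] /negP]].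
  by rewrite -leNgt => h; exists (w, x, y).
have [f hf] := choice bad.
have [|||w wN wcl] := @sliding (fun j => (f j).1.1)
  (fun j => (f j).1.2) (fun j => (f j).2).
- by move=> j; have [] := hf j.
- move=> j k /= h; have [_ ag _ _] := hf j; apply: ag => /=.
  rewrite ltNge; apply/negP => kw; move: h; apply/negP; rewrite -leNgt.
  by rewrite addr_ge0 ?dot_ge0 // mulr_ge0 // mulr_ge0.
- by move=> j; have [] := hf j.
have /expansive_locusE/(_ w wN) vw := vE.
pose e := `|dot v w| / 2.
have e0 : 0 < e by rewrite divr_gt0 // normr_gt0.
have far (w' : 'rV[R]_d) (j : nat) : dot w' w' = 1 ->
    dot v w' * dot (ivec (z j)) w' <= 0 -> e < `|dot v w'| -> j%:R * e <= D.
  move=> w1; have [b -> bD] := zv j; rewrite dotDl dotZl.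
  have bw := dot_unit_le w1 D0 bD.
  have := @dot_unit_le _ _ (- b) w' D w1 D0; rewrite !dotNl dotNr opprK => /(_ bD) bw'.
  have j0 : 0 <= j%:R :> R by [].
  move: (dot v w') (dot b w') bw bw' => s t st st'.
  case: (ltrgtP s 0) => s0; last by rewrite s0 normr0 ltNge (ltW e0).
    rewrite nmulr_rle0 // ltr0_norm // => h es.
    have : j%:R * e <= j%:R * - s by rewrite ler_wpM2l // ltW.
    by lra.
  rewrite pmulr_rle0 // gtr0_norm // => h es.
  have : j%:R * e <= j%:R * s by rewrite ler_wpM2l // ltW.
  by lra.
have near_e : \forall w' \near w, e < `|dot v w'|.
  move: vw; rewrite neq_lt => /orP[] vw.
    have : dot v w < - e by rewrite /e ltr0_norm //; lra.
    move=> /near_dot_lt; apply: filterS => w' w'e.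
    have := ler_norm (- dot v w'); rewrite normrN; apply: lt_le_trans.
    by rewrite ltrNr.
  have : e < dot v w by rewrite /e gtr0_norm //; lra.
  move=> /near_dot_gt; apply: filterS => w' w'e.
  exact: lt_le_trans w'e (ler_norm _).
have [j jN je] := wcl _ near_e (Num.bound (D / e)).
have [w1 _ _ h] := hf j; have := far _ j w1 h je.
rewrite -ler_pdivlMr // leNgt => /negP; apply.
apply: lt_le_trans (archi_boundP _) _; first by rewrite divr_ge0 // ltW.
by rewrite ler_nat.
Qed.

End HalfSpaces.

(** * Expansive components and cones *)

Section ComponentsAndCones.
Context {R : realType} {X : metricType R}.
Hypothesis compactX : compact [set: X].
Hypothesis zero_dimX : zero_dimensional X.
Hypothesis infiniteX : infinite_set [set: X].
Context {d : nat}.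
Variable alpha : 'rV[int]_d -> homeo X.
Hypothesis alphaD : forall m n, alpha (m + n) = (alpha m * alpha n)%g.
Implicit Types (m n k : 'rV[int]_d) (C : set 'rV[R]_d).

Local Notation K := (range alpha).
Local Notation ivec := (@intvec R d).

(** An expansive set is determined by closeness, hence by the symbols of a
    partition of small mesh. *)
Lemma expansive_set_pattern F : expansive_set alpha F ->
  exists (A : finType) (c : X -> A), locally_constant c /\
    forall x y, agree alpha c setT x y -> x = y.
Proof.
move=> [delta [t [delta0 _ exp]]].
have [A [c [cl mesh]]] := zero_dimensional_mesh compactX zero_dimX delta0.
exists A, c; split => // x y h; apply: exp => k _; apply/ltW/mesh; exact: h.
Qed.

Lemma expansive_expansive_set n : expansive (alpha n) -> expansive_set alpha setT.
Proof.
move=> [delta delta0 exp]; exists delta, 0; split => // x y h; apply: exp => j.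
rewrite !(alpha_expgz alphaD); apply: h.
by apply: (@dot_thickening _ _ _ _ _ (ivec (n *~ j))); rewrite // subrr dot0l expr0n.
Qed.

Lemma component_interior C n : expansive_component alpha C -> C (ivec n) ->
  expansive_elements K (alpha n) /\
  forall m, C (ivec m) <-> cone_interior K (LR_cone K (alpha n)) (alpha m).
Proof.
move=> [v vE CE] Cn.
have [A [c [cl gen]]] : exists (A : finType) (c : X -> A), locally_constant c /\
    forall x y, agree alpha c setT x y -> x = y.
  by have [[L [_ /expansive_set_pattern]]] := vE.
have locusE u := expansive_locusE compactX alphaD cl gen infiniteX u.
have expE k : expansive (alpha k) <-> expansive_locus alpha (ivec k).
  exact: iff_trans (expansive_alphaE compactX alphaD cl gen k) (iff_sym (locusE _)).
have inK k : K (alpha k) by exists k.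
have nE : expansive_locus alpha (ivec n).
  by move: Cn; rewrite CE => /connected_component_sub.
have Cnn : C = connected_component (expansive_locus alpha) (ivec n).
  by rewrite CE; apply: same_connected_component; rewrite -CE.
split; first by split => //; apply/expE.
move=> m; rewrite Cnn (component_same_side compactX alphaD cl gen infiniteX) //.
split=> [side|[[_ LR] [_ /expE mE]]].
  split; first by split => //; exact: same_side_LR side.
  split => //; apply/expE/locusE => w /side; apply: contraTneq => ->.
  by rewrite mulr0 ltxx.
move=> w wN; apply: (LR_same_side compactX alphaD cl gen LR wN).
  by move/locusE: nE; exact.
by move/locusE: mE; exact.
Qed.

Lemma expansive_component_of n : expansive (alpha n) ->
  exists2 C, expansive_component alpha C & C (ivec n).
Proof.
move=> nexp.
have [A [c [cl gen]]] := expansive_set_pattern (expansive_expansive_set nexp).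
have nE : expansive_locus alpha (ivec n).
  apply/(expansive_locusE compactX alphaD cl gen infiniteX).
  exact/(expansive_alphaE compactX alphaD cl gen n).
exists (connected_component (expansive_locus alpha) (ivec n)); first by exists (ivec n).
exact: connected_component_refl.
Qed.

Lemma component_has_integral_point C : expansive_component alpha C ->
  exists n, C (ivec n).
Proof.
move=> [v vE ->].
have [A [c [cl gen]]] : exists (A : finType) (c : X -> A), locally_constant c /\
    forall x y, agree alpha c setT x y -> x = y.
  by have [[L [_ /expansive_set_pattern]]] := vE.
exact: (component_integral compactX alphaD cl gen infiniteX vE).
Qed.

Lemma integral_points_component C n : expansive_component alpha C -> C (ivec n) ->
  integral_points C = Lambda alpha (cone_interior K (LR_cone K (alpha n))).
Proof.
move=> compC Cn; apply/seteqP; split => m; rewrite /integral_points /Lambda /=.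
  by have [_ ->] := component_interior compC Cn.
by have [_ <-] := component_interior compC Cn.
Qed.

Lemma expansive_SFT_POTP (tau : homeo X) :
  expansive tau -> conjugate_to_SFT tau <-> POTP tau.
Proof.
move=> tauE; split; first exact: SFT_POTP.
apply: POTP_SFT => //.
apply: contrapT => /set0P/negP; rewrite negbK => /eqP X0.
by apply: infiniteX; rewrite X0.
Qed.

End ComponentsAndCones.

Theorem theorem11p18 (R : realType) (X : metricType R)
    (compactX : compact [set: X])
    (zero_dimX : zero_dimensional X)
    (infiniteX : infinite_set [set: X])
    (d : nat) (psi : 'I_d -> homeo X)
    (psiC : forall i j, commute (psi i) (psi j)) :
  let K := generated_subgroup (range psi) in
  let alpha := Zd_action psi in
  [/\ forall m n : 'rV[int]_d,
        (exists2 C : set 'rV[R]_d, expansive_component alpha C &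
           C (intvec m) /\ C (intvec n)) <->
        (expansive_elements K (alpha n) /\
         cone_interior K (LR_cone K (alpha n)) (alpha m)),
      forall S : set 'rV[int]_d,
        (exists2 C : set 'rV[R]_d, expansive_component alpha C &
           S = integral_points C) <->
        (exists2 C : set (homeo X), is_weakly_LR_cone K C &
           S = Lambda alpha (cone_interior K C))
    & forall S : set 'rV[int]_d,
        (exists2 C : set 'rV[R]_d, Markov_component alpha C &
           S = integral_points C) <->
        (exists2 C : set (homeo X), is_ELR_cone K C &
           S = Lambda alpha (cone_interior K C))].
Proof.
move=> K alpha; have alphaD := Zd_actionD psiC.
have KE : K = range alpha := generated_subgroup_range psiC.
clearbody K; subst K.
have interior := component_interior compactX zero_dimX infiniteX alphaD.
have lattice := integral_points_component compactX zero_dimX infiniteX alphaD.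
have comp_of := expansive_component_of compactX zero_dimX infiniteX alphaD.
have point_of := component_has_integral_point compactX zero_dimX infiniteX alphaD.
have SFTE := expansive_SFT_POTP compactX zero_dimX infiniteX.
split.
- move=> m n; split => [[C compC [Cm Cn]]|[[_ nE] mn]].
    by have [nE mE] := interior C n compC Cn; split => //; exact/mE.
  have [C compC Cn] := comp_of n nE; exists C => //; split => //.
  by have [_ mE] := interior C n compC Cn; exact/mE.
- move=> S; split => [[C compC ->]|[_ [_ [[n _ <-] nE] ->] ->]].
    have [n Cn] := point_of C compC; have [nE _] := interior C n compC Cn.
    exists (LR_cone (range alpha) (alpha n)); last exact: lattice.
    by exists (alpha n).
  by have [C compC Cn] := comp_of n nE; exists C => //; rewrite (lattice C n).
- move=> S; split => [[C [compC [k Ck kSFT]] ->]|].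
    have [kE mE] := interior C k compC Ck.
    exists (LR_cone (range alpha) (alpha k)); last exact: lattice.
    split; first by exists (alpha k).
    exists (alpha k); first exact/mE.
    by case: kE => _ /SFTE[+ _]; exact.
  move=> [_ [[_ [[n _ <-] nE] ->] [phi phi_int phiP]] ->].
  have [_ [[k _ kphi] _]] := phi_int; subst phi.
  have [_ [_ kE]] := phi_int.
  have [C compC Cn] := comp_of n nE; have [_ mE] := interior C n compC Cn.
  exists C; last by rewrite (lattice C n).
  split => //; exists k; first exact/mE.
  exact/(SFTE _ kE).
Qed.
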